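(* Let $B$ be a standard one-dimensional Brownian motion, let $0<\gamma<1/2$, and let $C_\gamma\subset[1,2]$ and $f_\gamma$ be the middle $(1-2\gamma)$-Cantor set and the corresponding Cantor function on the interval $[1,2]$. Then $\mathbb{P}(\mathcal{Z}(B-f_\gamma)\cap C_\gamma\neq\emptyset)>0$ if and only if $\gamma\neq 1/4$.
   Context: $B=(B(t))_{t\ge0}$ starts at $0$. For a real function $g$ on a subset of $[0,\infty)$, $\mathcal{Z}(g)$ is the set of zeros of $g$ in $(0,\infty)$. Cantor set: let $I=[1,2]$. Let $\mathfrak{C}_{\gamma,1}$ consist of the two closed subintervals of $I$ of length $\gamma|I|$ sharing respectively the left and the right endpoint with $I$. Recursively, $\mathfrak{C}_{\gamma,n+1}$ consists of, for each $J\in\mathfrak{C}_{\gamma,n}$, the two closed subintervals of $J$ of length $\gamma^{n+1}|I|$ sharing respectively the left and the right endpoint with $J$. Let $C_{\gamma,n}$ be the union of the intervals in $\mathfrak{C}_{\gamma,n}$, and $C_\gamma=\bigcap_{n\ge1}C_{\gamma,n}$. Cantor function: $f_{\gamma,1}$ is $0$ at the left endpoint of $I$, $1$ at the right endpoint, $1/2$ on $I\setminus C_{\gamma,1}$, and linear on each interval of $\mathfrak{C}_{\gamma,1}$ (continuous). Recursively, $f_{\gamma,n+1}$ agrees with $f_{\gamma,n}$ off $C_{\gamma,n}$, and for every $J=[s,t]\in\mathfrak{C}_{\gamma,n}$ it agrees with $f_{\gamma,n}$ at $s$ and $t$, equals $(f_{\gamma,n}(s)+f_{\gamma,n}(t))/2$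 on $J\setminus C_{\gamma,n+1}$ and is linear on each interval of $\mathfrak{C}_{\gamma,n+1}$ (continuous). The functions $f_{\gamma,n}$ converge uniformly on $I$, and $f_\gamma=\lim_n f_{\gamma,n}$. The function is extended by $f_\gamma=0$ on $[0,1)$ and $f_\gamma=1$ on $(2,\infty)$. *)

(* Defs.v *)
From HB Require Import structures.
From mathcomp Require Import all_boot all_order all_algebra.
From mathcomp Require Import all_classical all_reals all_analysis.

Set Implicit Arguments.
Unset Strict Implicit.
Unset Printing Implicit Defensive.

Import Order.TTheory GRing.Theory Num.Theory.
Import numFieldNormedType.Exports.

Local Open Scope classical_set_scope.
Local Open Scope ring_scope.

(* Taking some of the [A i] equal to [setT] gives the product rule for every
   subfamily. *)
Definition mutually_independent (d : measure_display) (T : measurableType d)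
    (R : realType) (P : probability T R) (n : nat) (X : 'I_n -> T -> R) : Prop :=
  forall A : 'I_n -> set R, (forall i, measurable (A i)) ->
    P (\bigcap_(i in [set: 'I_n]) (X i @^-1` A i)) =
    (\prod_(i < n) P (X i @^-1` A i))%E.

(* Only the times t >= 0 matter; the random variables [B t] with t < 0 are
   unconstrained.  The second parameter of [normal_prob] is the standard
   deviation.  Paths are continuous surely, not just almost surely, so that
   events such as "B hits f on C" are measurable. *)
Record standard_brownian_motion (d : measure_display) (T : measurableType d)
    (R : realType) (P : probability T R) (B : R -> {RV P >-> R}) : Prop := {
  bm_start : forall w, B 0 w = 0 ;
  bm_independent_increments : forall (n : nat) (t : nat -> R),
    0 <= t 0%N -> (forall i, t i <= t i.+1) ->
    mutually_independent P
      (fun (i : 'I_n) w => B (t i.+1) w - B (t i) w) ;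
  bm_normal_increments : forall s t : R, 0 <= s -> s < t ->
    forall A : set R, measurable A ->
      P ((fun w => B t w - B s w) @^-1` A) =
      normal_prob 0 (Num.sqrt (t - s)) A ;
  bm_continuous_paths : forall w,
    {within `[0, +oo[, continuous (fun t : R => B t w : R)}
}.

Definition zeros (R : realType) (g : R -> R) : set R :=
  [set t | 0 < t /\ g t = 0].

Section cantor.
Variables (R : realType) (gamma : R).

(* A pair (s, t) encodes the interval [s, t].  Stage 0 is the single interval
   I = [1, 2], for which |I| = 1. *)
Fixpoint cantor_intervals (n : nat) : seq (R * R) :=
  if n is m.+1 then
    flatten [seq [:: (J.1, J.1 + gamma ^+ m.+1); (J.2 - gamma ^+ m.+1, J.2)]
            | J <- cantor_intervals m]
  else [:: (1, 2)].

Definition cantor_stage (n : nat) : set R :=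
  [set x | exists2 J, J \in cantor_intervals n & x \in `[J.1, J.2]].

Definition cantor_set : set R :=
  \bigcap_(n in [set n | (1 <= n)%N]) cantor_stage n.

(* The affine function through (a, ya) and (b, yb). *)
Definition affine_interp (a b ya yb x : R) : R :=
  ya + (yb - ya) * ((x - a) / (b - a)).

(* The modification of [f] on J = [s, t] when the two children of J have
   length [l]. *)
Definition cantor_refine (l : R) (f : R -> R) (J : R * R) (x : R) : R :=
  let: (s, t) := J in
  let mid := (f s + f t) / 2 in
  if x <= s + l then affine_interp s (s + l) (f s) mid x
  else if x < t - l then mid
  else affine_interp (t - l) t mid (f t) x.

(* Starting at n = 0 from the affine function with values 0 at 1 and 1 at 2,
   the recursion step yields the usual f_1 for n = 1.  When 0 < gamma < 1/2 the
   intervals of a given stage are disjoint, so at most one J contains x. *)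
Fixpoint cantor_approx (n : nat) : R -> R :=
  if n is m.+1 then
    let f := cantor_approx m in
    fun x =>
      if [seq J <- cantor_intervals m | x \in `[J.1, J.2]] is J :: _
      then cantor_refine (gamma ^+ m.+1) f J x
      else f x
  else fun x => x - 1.

Definition cantor_function (x : R) : R :=
  if x < 1 then 0 else if 2 < x then 1
  else limn (fun n => cantor_approx n x).

End cantor.

(* Main.v *)
Require Import Defs.
From HB Require Import structures.
From mathcomp Require Import all_boot all_order all_algebra.
From mathcomp Require Import all_classical all_reals all_analysis.
From mathcomp Require Import measurable_realfun ring lra zify.

(* For j < 2^n let a_n(j) be the left endpoint of the stage-n interval with address j, so
   that f(a_n(j)) = j / 2^n.  By compactness, B hits f on the Cantor set iff for every
   e > 0 some grid point satisfies |B(a_n(j)) - j / 2^n| <= e.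

   If gamma <> 1/4, put windows of radius eps / 2^N around the points j / 2^N.  The
   probabilities that B(a_N(j)) lies in its window add up to at least c eps.  If the
   addresses i < j first differ after m digits, the increment has standard deviation of
   order s^m with s = sqrt gamma, and the Gaussian factor penalises the required jump
   (j - i) / 2^N.  Bounding this factor by 1 when 2 s > 1, and summing it over j - i
   when 2 s < 1, one gets a sum over pairs of at most C eps^2 (1 + rho + rho^2 + ...) with
   rho = min (2 s) (1 / (2 s)) < 1.  Bonferroni's inequality with a small fixed eps bounds
   the probability of a window hit from below, uniformly in N.

   If gamma = 1/4, take depth 3 r and windows of radius 4^-r.  After a first window hit
   at address i, each zero digit of i among the 2 r leading ones opens a block of later
   addresses that contributes a fixed multiple of 2^r to the expected number of further
   hits (of doubled windows), while the unconditional expectation is at most 4 * 2^r.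
   Hence the first-hit address has K zero digits there with probability O(1 / K), and the
   addresses with fewer than K zero digits are too few to matter.  Chaining along the tree
   of intervals controls the oscillation of B between points of the grid. *)

Set Implicit Arguments.
Unset Strict Implicit.
Unset Printing Implicit Defensive.

Import Order.TTheory GRing.Theory Num.Theory.
Import numFieldNormedType.Exports.

Local Open Scope classical_set_scope.
Local Open Scope ring_scope.

Lemma half_itv01 (R : realType) : 0 <= (2 : R)^-1 < 1.
Proof. by lra. Qed.

Lemma expr_lt_eventually (R : realType) (q e : R) : 0 <= q < 1 -> 0 < e ->
  exists N, forall n, (N <= n)%N -> q ^+ n < e.
Proof.
move=> /andP[q0 q1] e0.
have : (fun n => q ^+ n) @ \oo --> (0 : R) by apply: cvg_expr; rewrite ger0_norm.
move/cvgrPdist_lt => /(_ e e0) [N _ hN]; exists N => n Nn.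
by have := hN n Nn; rewrite /= sub0r normrN ger0_norm ?exprn_ge0.
Qed.

(** * Upper and lower bounds for centred Gaussian probabilities *)

Section normal_bounds.
Context {R : realType}.
Implicit Types s u v w x y : R.

(** Square [1 + x / 2 <= expR (x / 2)]. This rational decay makes Gaussian sums telescope and turns
    the exponential tail into a fourth-power one. *)
Lemma expRN_le_inv_sqr x : 0 <= x -> expR (- x) <= 4 / (1 + x) ^+ 2.
Proof.
move=> x0; have h : (1 + x / 2) ^+ 2 <= expR x.
  rewrite [in leRHS](_ : x = x / 2 *+ 2); last by rewrite -mulr_natr divfK.
  have x20 : 0 <= 1 + x / 2 by lra.
  by rewrite mulr2n expRD -expr2 ler_pXn2r ?nnegrE ?expR_ge0// expR_ge1Dx.
rewrite expRN -[leRHS]invrK lef_pV2 ?posrE ?expR_gt0 ?invr_gt0 ?divr_gt0 ?exprn_gt0//; last lra.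
by apply: le_trans h; rewrite invf_div; nra.
Qed.

Lemma normal_peak_le s : 0 < s -> normal_peak s <= s^-1.
Proof.
move=> s0; rewrite /normal_peak lef_pV2 ?posrE ?sqrtr_gt0//; last first.
  by rewrite mulrn_wgt0// mulr_gt0 ?pi_gt0// exprn_gt0.
rewrite -ler_sqr ?nnegrE ?sqrtr_ge0 ?ltW// sqr_sqrtr; last first.
  by rewrite mulrn_wge0// mulr_ge0 ?pi_ge0// sqr_ge0.
have := pi_ge2 R; have := exprn_gt0 2 s0; nra.
Qed.

Lemma normal_peak_ge s : 0 < s -> (3 * s)^-1 <= normal_peak s.
Proof.
move=> s0; rewrite /normal_peak lef_pV2 ?posrE ?sqrtr_gt0 ?mulr_gt0//; last first.
  by rewrite mulrn_wgt0// mulr_gt0 ?pi_gt0// exprn_gt0.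
have s30 : 0 <= 3 * s by rewrite mulr_ge0// ltW.
rewrite -ler_sqr ?nnegrE ?sqrtr_ge0// sqr_sqrtr; last first.
  by rewrite mulrn_wge0// mulr_ge0 ?pi_ge0// sqr_ge0.
have /andP[_ h] := @pihalf_02 R.
have pi4 : pi < 4 :> R by lra.
by have := exprn_gt0 2 s0; rewrite exprMn; nra.
Qed.

Local Notation mu := (@lebesgue_measure R).

(** On the interval the density is at most its peak times the exponential at [w]. With [w] free, the
    exponential factor can be kept or discarded ([w = 0]). *)
Lemma normal_prob_itv_le s u v w : 0 < s -> u <= v ->
  (forall x, u <= x <= v -> w <= x ^+ 2) ->
  (normal_prob 0 s `[u, v] <= ((v - u) / s * expR (- w / (s ^+ 2 *+ 2)))%:E)%E.
Proof.
move=> s0 uv hw; rewrite /normal_prob.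
apply: (@le_trans _ _
  (\int[mu]_(x in `[u, v]) (s^-1 * expR (- w / (s ^+ 2 *+ 2)))%:E)%E).
  apply: ge0_le_integral => //=.
  - by move=> x _; rewrite lee_fin normal_pdf_ge0.
  - by apply/measurable_EFinP; apply: measurable_funTS; exact: measurable_normal_pdf.
  move=> x; rewrite in_itv/= => xuv.
  rewrite lee_fin normal_pdfE ?gt_eqF// ler_pM ?normal_peak_ge0 ?normal_fun_ge0 ?normal_peak_le//.
  rewrite /normal_fun ler_expR subr0 !mulNr lerN2 ler_pM2r ?hw// invr_gt0.
  by rewrite mulrn_wgt0// exprn_gt0.
rewrite integral_cst//= lebesgue_measure_itv/= lte_fin; case: ifPn => h.
  by rewrite -EFinD -EFinM lee_fin mulrC mulrA.
rewrite mule0 lee_fin mulr_ge0 ?expR_ge0// mulr_ge0 ?subr_ge0// invr_ge0 ltW//.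
Qed.

Lemma normal_prob_itv_ge s u v w : 0 < s -> u <= v ->
  (forall x, u <= x <= v -> x ^+ 2 <= w) ->
  (((v - u) / (3 * s) * expR (- w / (s ^+ 2 *+ 2)))%:E <= normal_prob 0 s `[u, v])%E.
Proof.
move=> s0 uv hw; rewrite /normal_prob.
have e0 : 0 <= (3 * s)^-1 * expR (- w / (s ^+ 2 *+ 2)).
  by rewrite mulr_ge0 ?expR_ge0// invr_ge0 mulr_ge0// ltW.
apply: (@le_trans _ _
  (\int[mu]_(x in `[u, v]) ((3 * s)^-1 * expR (- w / (s ^+ 2 *+ 2)))%:E)%E).
  rewrite integral_cst//= lebesgue_measure_itv/= lte_fin; case: ifPn => h.
    by rewrite -EFinD -EFinM lee_fin -mulrA mulrC.
  have -> : u = v by apply/le_anti; rewrite uv leNgt.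
  by rewrite mule0 lee_fin subrr mul0r mul0r.
apply: ge0_le_integral => //=.
- by apply/measurable_EFinP; apply: measurable_funTS; exact: measurable_normal_pdf.
move=> x; rewrite in_itv/= => xuv.
rewrite lee_fin normal_pdfE ?gt_eqF// ler_pM ?expR_ge0 ?normal_peak_ge//.
  by rewrite invr_ge0 mulr_ge0// ltW.
rewrite /normal_fun ler_expR subr0 !mulNr lerN2 ler_pM2r ?hw// invr_gt0.
by rewrite mulrn_wgt0// exprn_gt0.
Qed.

Lemma measurable_norm_gt (y : R) : measurable [set x : R | y < `|x|].
Proof.
rewrite (_ : [set x | _] = (@Num.norm R R) @^-1` `]y, +oo[); last first.
  by apply/seteqP; split=> x /=; rewrite in_itv/= andbT.
by rewrite -[X in measurable X]setTI; exact: normr_measurable.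
Qed.

(* Halving the exponent of the density gives, up to the factor [Num.sqrt 2], the
   density of standard deviation [Num.sqrt 2 * s], whose integral is [1]. *)
Lemma normal_prob_tail s y : 0 < s -> 0 < y ->
  (normal_prob 0 s [set x | (y < `|x|)%R] <= (2 * expR (- (y ^+ 2 / (s ^+ 2 *+ 4))))%:E)%E.
Proof.
move=> s0 y0; set D := [set x | _].
have mD : measurable D by exact: measurable_norm_gt.
pose s' := Num.sqrt 2 * s.
have s'0 : 0 < s' by rewrite mulr_gt0// sqrtr_gt0.
have s'2 : s' ^+ 2 = 2 * s ^+ 2 by rewrite exprMn sqr_sqrtr.
rewrite /normal_prob.
apply: (@le_trans _ _
  (\int[mu]_(x in D) ((2 * expR (- (y ^+ 2 / (s ^+ 2 *+ 4))))%:E * (normal_pdf 0 s' x)%:E))%E).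
  apply: ge0_le_integral => //=.
  - by move=> x _; rewrite lee_fin normal_pdf_ge0.
  - by apply/measurable_EFinP; apply: measurable_funTS; exact: measurable_normal_pdf.
  - apply/measurable_EFinP; apply: measurable_funTS; apply: measurable_funM => //.
    exact: measurable_normal_pdf.
  move=> x /= yx.
  rewrite -EFinM lee_fin !normal_pdfE ?gt_eqF//.
  have -> : normal_peak s = Num.sqrt 2 * normal_peak s'.
    rewrite /normal_peak s'2 (_ : 2 * s ^+ 2 * pi *+ 2 = 2 * (s ^+ 2 * pi *+ 2)); last by ring.
    by rewrite sqrtrM// invfM mulrA divff ?mul1r// gt_eqF// sqrtr_gt0.
  have h2 : Num.sqrt 2 <= 2 :> R.
    by rewrite -ler_sqr ?nnegrE ?sqrtr_ge0// sqr_sqrtr//; lra.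
  rewrite mulrACA ler_pM ?mulr_ge0 ?normal_peak_ge0 ?sqrtr_ge0 ?normal_fun_ge0//.
    by rewrite ler_wpM2r// normal_peak_ge0.
  rewrite /normal_fun -expRD ler_expR !subr0 s'2.
  have y2x : y ^+ 2 <= x ^+ 2 by rewrite -(real_normK (num_real x)) ler_pXn2r ?nnegrE// ltW.
  have s20 : 0 < s ^+ 2 by rewrite exprn_gt0.
  rewrite (_ : - x ^+ 2 / (s ^+ 2 *+ 2) = - (x ^+ 2 / (s ^+ 2 *+ 4)) - x ^+ 2 / (2 * s ^+ 2 *+ 2)).
    by rewrite mulNr lerD2r lerN2 ler_pM2r// invr_gt0 mulrn_wgt0.
  by field; rewrite gt_eqF.
have mpdf E : measurable_fun E (fun x => (normal_pdf 0 s' x)%:E).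
  by apply/measurable_EFinP; apply: measurable_funTS; exact: measurable_normal_pdf.
have pdf0 x : (0 <= (normal_pdf 0 s' x)%:E)%E by rewrite lee_fin normal_pdf_ge0.
have c0 : (0 <= (2 * expR (- (y ^+ 2 / (s ^+ 2 *+ 4))))%:E)%E.
  by rewrite lee_fin mulr_ge0 ?expR_ge0.
rewrite (ge0_integralZl mu mD (mpdf D) (fun x _ => pdf0 x) c0).
rewrite -[leRHS]mule1 lee_wpmul2l ?lee_fin ?mulr_ge0 ?expR_ge0//.
rewrite -(integral_normal_pdf 0 s'); apply: ge0_subset_integral => //; exact: mpdf.
Qed.

Lemma normal_prob_tail_inv4 s y : 0 < s -> 0 < y ->
  (normal_prob 0 s [set x | (y < `|x|)%R] <= (128 * (s / y) ^+ 4)%:E)%E.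
Proof.
move=> s0 y0; apply: (le_trans (normal_prob_tail s0 y0)); rewrite lee_fin.
set z := y ^+ 2 / _.
have z0 : 0 < z by rewrite divr_gt0 ?mulrn_wgt0 ?exprn_gt0.
have -> : 128 * (s / y) ^+ 4 = 2 * (4 / z ^+ 2).
  by rewrite /z; field; rewrite !gt_eqF.
rewrite ler_pM2l//; apply: (le_trans (expRN_le_inv_sqr (ltW z0))).
by rewrite ler_pM2l// lef_pV2 ?posrE ?exprn_gt0//; nra.
Qed.

End normal_bounds.

Lemma sum_expr_le (R : realType) (q : R) n : 0 <= q < 1 -> \sum_(i < n) q ^+ i <= (1 - q)^-1.
Proof.
move=> /andP[q0 q1]; have q10 : 0 < 1 - q by lra.
rewrite -[leRHS]mul1r ler_pdivlMr//.
have -> : (\sum_(i < n) q ^+ i) * (1 - q) = 1 - q ^+ n.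
  elim: n => [|n ih]; first by rewrite big_ord0 mul0r expr0 subrr.
  by rewrite big_ord_recr /= mulrDl ih exprS; ring.
by rewrite lerBlDr lerDl exprn_ge0.
Qed.

(** * Binary addresses, the Cantor set and values of the Cantor function on it *)

Section cantor_geometry.
Context {R : realType}.
Variable g : R.

(* For [j < 2 ^ n] this is the left endpoint of the stage-[n] interval whose
   address is the binary expansion of [j]; the value [1 + 2 j] at [n = 0] makes it
   increasing in [j] without bounds on [j]. *)
Fixpoint cantor_left (n j : nat) : R :=
  if n is m.+1 then cantor_left m j./2 + (odd j)%:R * ((1 - g) * g ^+ m)
  else 1 + 2 * j%:R.

Local Notation a := cantor_left.

Lemma cantor_leftS_even n j : a n.+1 j.*2 = a n j.
Proof. by rewrite /= doubleK odd_double mul0r addr0. Qed.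

Lemma cantor_leftS_odd n j : a n.+1 j.*2.+1 = a n j + (1 - g) * g ^+ n.
Proof. by rewrite /= uphalf_double odd_double mul1r. Qed.

Lemma cantor_left_mul2X n j k : a (k + n) (j * 2 ^ k) = a n j.
Proof.
elim: k => [|k ih]; first by rewrite muln1.
by rewrite addSn expnSr mulnA muln2 cantor_leftS_even.
Qed.

Lemma mem_cantor_intervals n J :
  J \in cantor_intervals g n <-> exists2 j, (j < 2 ^ n)%N & J = (a n j, a n j + g ^+ n).
Proof.
elim: n J => [|n ih] J /=.
  rewrite inE expr0; split=> [/eqP ->|[j]].
    by exists 0%N => //=; congr pair; rewrite ?mulr0 ?addr0.
  by rewrite expn0 ltnS leqn0 => /eqP -> ->; rewrite !mulr0 !addr0.
split=> [/flatten_mapP [I /ih [j jn ->]]|[j jn ->]] /=.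
  rewrite !inE => /orP [/eqP -> | /eqP ->].
    exists j.*2; first by rewrite expnS mul2n ltn_double.
    by rewrite doubleK odd_double mul0r addr0.
  exists j.*2.+1; first by rewrite expnS mul2n ltn_Sdouble.
  rewrite /= uphalf_double odd_double mul1r; congr pair; rewrite exprS; ring.
apply/flatten_mapP; exists (a n j./2, a n j./2 + g ^+ n).
  apply/ih; exists j./2 => //; move: jn; rewrite expnS mul2n => jn.
  by rewrite -ltn_double (leq_ltn_trans _ jn)// -[leqRHS]odd_double_half leq_addl.
rewrite !inE; case: (odd j) => /=.
  by apply/orP; right; apply/eqP; congr pair; rewrite ?mul1r exprS; ring.
by apply/orP; left; apply/eqP; rewrite mul0r addr0.
Qed.

Hypotheses (g0 : 0 < g) (g1 : g < 1 / 2).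

Let gX n : 0 < g ^+ n. Proof. by rewrite exprn_gt0. Qed.

Let gX1 n : 0 < (1 - 2 * g) * g ^+ n.
Proof. by apply: mulr_gt0; [move: g1; lra|exact: gX]. Qed.

(** The bound is the length [g ^+ n] of an interval plus the gap [(1 - 2 * g) * g ^+ n]. If the
    parents differ, the bound for them absorbs the shift of a right child; siblings are exactly one
    shift apart. Both cases use [g < 1 / 2]. *)
Lemma cantor_left_gap n i j : (i < j)%N -> (2 - 2 * g) * g ^+ n <= a n j - a n i.
Proof.
have hg0 := g0; have hg1 := g1.
elim: n i j => [|n ih] i j ij /=.
  have ij1 : i%:R + 1 <= j%:R :> R by rewrite natr1 ler_nat.
  by rewrite ?expr0 ?mulr1; lra.
have gn := gX n; have gn1 := gX1 n; have k : (2 - 2 * g) * g ^+ n.+1 <= (1 - g) * g ^+ n.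
  by rewrite exprS; nra.
apply: (le_trans k).
case: (ltngtP i./2 j./2) => h.
- have := ih _ _ h; case: (odd i); case: (odd j) => /=; nra.
- by move/half_leq : (ltnW ij); rewrite leqNgt h.
- have : odd i = false /\ odd j = true.
    by move: ij; rewrite -(odd_double_half i) -(odd_double_half j) h ltn_add2r !oddD !odd_double;
     case: (odd i); case: (odd j).
  by move=> [-> ->]; rewrite h /=; nra.
Qed.

Lemma cantor_left_inj_itv n i j x :
  a n i <= x <= a n i + g ^+ n -> a n j <= x <= a n j + g ^+ n -> i = j.
Proof.
have hg0 := g0; have hg1 := g1.
move=> /andP[h1 h2] /andP[h3 h4]; have gn := gX n; have gn1 := gX1 n.
by case: (ltngtP i j) => // /(cantor_left_gap n) h; exfalso; lra.
Qed.

Lemma cantor_left_parent n j :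
  a n j./2 <= a n.+1 j /\ a n.+1 j + g ^+ n.+1 <= a n j./2 + g ^+ n.
Proof.
have hg0 := g0; have hg1 := g1.
have gn : 0 <= (1 / 2 - g) * g ^+ n by apply: mulr_ge0; rewrite ?subr_ge0 ltW.
have gn' := gX n; rewrite exprS /=; case: (odd j) => /=; split; rewrite ?mul1r ?mul0r; lra.
Qed.

(** Division by [2 ^ k] deletes the last [k] binary digits, which gives the address of the enclosing
    interval [k] stages up. *)
Lemma cantor_left_ancestor n k j :
  a n (j %/ 2 ^ k) <= a (k + n) j /\
  a (k + n) j + g ^+ (k + n) <= a n (j %/ 2 ^ k) + g ^+ n.
Proof.
elim: k j => [|k ih] j; first by rewrite divn1; split.
have [h1 h2] := cantor_left_parent (k + n) j; have [h3 h4] := ih j./2.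
by rewrite expnS divnMA divn2 addSn; split; [exact: le_trans h1|exact: le_trans h4].
Qed.

Lemma cantor_left_ge1 n j : 1 <= a n j.
Proof.
have [h _] := cantor_left_ancestor 0 n j; apply: le_trans; last by rewrite addn0 in h; exact: h.
by rewrite /= lerDl mulr_ge0.
Qed.

Lemma cantor_left_le2 n j : (j < 2 ^ n)%N -> a n j + g ^+ n <= 2.
Proof.
move=> jn; have [_ h] := cantor_left_ancestor 0 n j; rewrite addn0 in h.
by apply: le_trans h _; rewrite divn_small//= mulr0 addr0 expr0.
Qed.

(* [m] is the length of the longest common prefix of the two addresses. *)
Lemma cantor_left_split (m l i j q : nat) :
  (i %/ 2 ^ l = q.*2)%N -> (j %/ 2 ^ l = q.*2.+1)%N ->
  (1 - 2 * g) * g ^+ m <= a (l + m.+1) j - a (l + m.+1) i <= g ^+ m.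
Proof.
have hg0 := g0; have hg1 := g1.
move=> hi hj; have gm := gX m.
have [i1 i2] := cantor_left_ancestor m.+1 l i; have [j1 j2] := cantor_left_ancestor m.+1 l j.
have gl := gX (l + m.+1).
move: i1 i2 j1 j2; rewrite hi hj cantor_leftS_even cantor_leftS_odd (exprS g m) => i1 i2 j1 j2.
by apply/andP; split; nra.
Qed.

Lemma cantor_setP t : cantor_set g t <->
  forall n, exists2 j, (j < 2 ^ n)%N & a n j <= t <= a n j + g ^+ n.
Proof.
split=> [Ct n|h n _ /=]; last first.
  have [j jn jt] := h n; exists (a n j, a n j + g ^+ n); last by rewrite in_itv.
  by apply/mem_cantor_intervals; exists j.
(* Going through stage [n.+1] covers [n = 0], which the intersection defining [cantor_set] leaves
   out. *)
have [J /mem_cantor_intervals[j jn ->]] := Ct n.+1 isT.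
rewrite in_itv/= => /andP[h1 h2]; exists j./2.
  move: jn; rewrite expnS mul2n => jn.
  by rewrite -ltn_double (leq_ltn_trans _ jn)// -[leqRHS]odd_double_half leq_addl.
have [h3 h4] := cantor_left_parent n j.
by apply/andP; split; [exact: le_trans h1|exact: le_trans h4].
Qed.

(** At deeper stages the point remains a left endpoint, its address being padded with zeros; at
    earlier stages it lies in the ancestors of its interval. *)
Lemma cantor_left_in n j : (j < 2 ^ n)%N -> cantor_set g (a n j).
Proof.
move=> jn; apply/cantor_setP => m; case: (leqP n m) => h.
  exists (j * 2 ^ (m - n))%N; first by rewrite -(subnK h) expnD mulnC addnK ltn_pmul2l ?expn_gt0.
  have -> : a m (j * 2 ^ (m - n)) = a n j by rewrite -{1}(subnK h) cantor_left_mul2X.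
  by rewrite lexx lerDl ltW.
have [h1 h2] := cantor_left_ancestor m (n - m) j; rewrite subnK ?(ltnW h)// in h1 h2.
exists (j %/ 2 ^ (n - m))%N; first by rewrite ltn_divLR ?expn_gt0// -expnD subnKC// ltnW.
by rewrite h1 (le_trans _ h2)// lerDl ltW.
Qed.

(** Each refinement halves the rise over an interval and gives one half to each child, so the [n]-th
    approximation maps interval [j] affinely onto the dyadic interval from [j / 2 ^ n] to
    [(j + 1) / 2 ^ n]. *)
Lemma cantor_approxE n j x : (j < 2 ^ n)%N -> a n j <= x <= a n j + g ^+ n ->
  cantor_approx g n x = (j%:R + (x - a n j) / g ^+ n) / 2 ^+ n.
Proof.
have hg0 := g0; have hg1 := g1.
elim: n j x => [|n ih] j x jn hx /=.
  by move: jn; rewrite expn0 ltnS leqn0 => /eqP ->; rewrite mulr0 !expr0 !divr1; ring.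
have j2n : (j./2 < 2 ^ n)%N.
  move: jn; rewrite expnS mul2n => jn.
  by rewrite -ltn_double (leq_ltn_trans _ jn)// -[leqRHS]odd_double_half leq_addl.
have [h3 h4] := cantor_left_parent n j.
have hx' : a n j./2 <= x <= a n j./2 + g ^+ n.
  by case/andP: hx => h1 h2; rewrite (le_trans h3 h1) (le_trans h2 h4).
set s := [seq _ <- _ | _].
(* Intervals of one stage are disjoint, so every entry of the filtered list is the parent interval,
   whatever the order of the list. *)
have sP J : J \in s -> J = (a n j./2, a n j./2 + g ^+ n).
  rewrite mem_filter in_itv/= => /andP[xJ /mem_cantor_intervals[k _ kJ]].
  by rewrite kJ /= in xJ *; rewrite (cantor_left_inj_itv hx' xJ).
have : (a n j./2, a n j./2 + g ^+ n) \in s.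
  by rewrite mem_filter in_itv/= hx'/=; apply/mem_cantor_intervals; exists j./2.
case: s sP => // J s /(_ J); rewrite inE eqxx => /(_ isT) -> _.
have gn := gX n; have gn1 := gX1 n; have gnN : g ^+ n != 0 by rewrite gt_eqF.
have gN : g != 0 by rewrite gt_eqF.
have e2 : (2 ^+ n : R) != 0 by rewrite expf_neq0.
rewrite /cantor_refine (ih _ _ j2n) ?lexx ?lerDl ?(ltW gn)//.
rewrite (ih _ _ j2n) ?lexx ?lerDl ?(ltW gn)// subrr mul0r addr0.
have -> : a n j./2 + g ^+ n - a n j./2 = g ^+ n by ring.
rewrite divff// /affine_interp !exprS.
have jE : j%:R = (odd j)%:R + 2 * j./2%:R :> R.
  by rewrite -{1}(odd_double_half j) natrD -muln2 natrM mulrC.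
case/andP: hx => /=; rewrite exprS jE; case: (odd j) => /= hx1 hx2.
  rewrite ifF; last by apply/negbTE; rewrite -ltNge; lra.
  rewrite ifF; last by apply/negbTE; rewrite -leNgt; lra.
  field; rewrite e2 gnN gN /= (_ : _ - _ = g * g ^+ n) ?mulf_neq0//; ring.
rewrite ifT; last by lra.
field; rewrite e2 gnN gN /= (_ : _ - _ = g * g ^+ n) ?mulf_neq0//; ring.
Qed.

(** The stage-[m] interval around [t] has [j] as its ancestor, so the first [n] binary digits of its
    value are those of [j]. *)
Lemma cantor_approx_itv n m j t : (n <= m)%N -> cantor_set g t ->
  a n j <= t <= a n j + g ^+ n ->
  j%:R / 2 ^+ n <= cantor_approx g m t <= (j%:R + 1) / 2 ^+ n.
Proof.
move=> nm /cantor_setP /(_ m) [i im it] jt.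
have [h1 h2] := cantor_left_ancestor n (m - n) i; rewrite subnK// in h1 h2.
have ij : (i %/ 2 ^ (m - n) = j)%N.
  apply: (cantor_left_inj_itv _ jt).
  by case/andP: it => i1 i2; rewrite (le_trans h1 i1) (le_trans i2 h2).
have : 0 <= (t - a m i) / g ^+ m <= 1.
  case/andP: it => i1 i2; rewrite divr_ge0 ?subr_ge0 ?(ltW (gX _))//=.
  by rewrite ler_pdivrMr ?gX// mul1r lerBlDl.
rewrite (cantor_approxE im it) => /andP[]; set e := _ / g ^+ m => e0 e1.
have mE : (2 : R) ^+ m = 2 ^+ (m - n) * 2 ^+ n by rewrite -exprD subnK.
have p2 k : 0 < (2 : R) ^+ k by rewrite exprn_gt0.
rewrite mE invfM mulrA !ler_pM2r ?invr_gt0// ler_pdivlMr// ler_pdivrMr//.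
have := divn_eq i (2 ^ (m - n)); rewrite ij => iE.
have := ltn_pmod i (expn_gt0 2 (m - n) : (0 < 2 ^ (m - n))%N) => rlt.
have {}iE : i%:R = j%:R * 2 ^+ (m - n) + (i %% 2 ^ (m - n))%:R :> R.
  by rewrite {1}iE natrD natrM natrX.
have r1 : (i %% 2 ^ (m - n))%:R + 1 <= 2 ^+ (m - n) :> R by rewrite natr1 -natrX ler_nat.
have r0 : 0 <= (i %% 2 ^ (m - n))%:R :> R by [].
by rewrite iE; apply/andP; split; lra.
Qed.

Lemma cantor_approx_cvg t : cantor_set g t -> cvgn (fun n => cantor_approx g n t).
Proof.
move=> Ct; apply: cauchy_cvg; apply: cauchy_exP => _/posnumP[e].
have [n /(_ n (leqnn n)) ne] := expr_lt_eventually (half_itv01 R) (gt0 e).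
have [j _ jt] := (cantor_setP t).1 Ct n.
exists (cantor_approx g n t); exists n => //= m nm.
have := cantor_approx_itv nm Ct jt; have := cantor_approx_itv (leqnn n) Ct jt.
rewrite mulrDl mul1r -exprVn => h1 h2.
by apply: le_lt_trans ne; rewrite ler_norml; lra.
Qed.

Lemma cantor_function_itv n j t : cantor_set g t -> a n j <= t <= a n j + g ^+ n ->
  j%:R / 2 ^+ n <= cantor_function g t <= (j%:R + 1) / 2 ^+ n.
Proof.
move=> Ct jt; rewrite /cantor_function.
have [i i1 /andP[t1 t2]] := (cantor_setP t).1 Ct 0%N.
have {}i1 : i = 0%N by move: i1; rewrite expn0 ltnS leqn0 => /eqP.
rewrite i1 /= mulr0 addr0 in t1 t2.
rewrite ltNge t1/= ltNge (le_trans t2)/=; last by rewrite expr0.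
have cv := cantor_approx_cvg Ct.
apply/andP; split; [apply: limr_ge => //|apply: limr_le => //];
  near=> m; (have nm : (n <= m)%N by near: m; exists n);
  by case/andP: (cantor_approx_itv nm Ct jt).
Unshelve. all: end_near. Qed.

(** The same point has address [j * 2 ^ k] at depth [k + n], so the enclosing dyadic intervals
    shrink to their common left end as [k] grows. *)
Lemma cantor_function_left n j : (j < 2 ^ n)%N -> cantor_function g (a n j) = j%:R / 2 ^+ n.
Proof.
move=> jn; have Cj := cantor_left_in jn.
have h k : j%:R / 2 ^+ n <= cantor_function g (a n j) <= j%:R / 2 ^+ n + 2^-1 ^+ k.
  have := @cantor_function_itv (k + n) (j * 2 ^ k) (a n j) Cj.
  rewrite cantor_left_mul2X lexx lerDl (ltW (gX _)) => /(_ isT).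
  have p2 l : 0 < (2 : R) ^+ l by rewrite exprn_gt0.
  have -> : (j * 2 ^ k)%:R / (2 : R) ^+ (k + n) = j%:R / 2 ^+ n.
    by rewrite natrM natrX exprD; field; rewrite !gt_eqF.
  move=> /andP[-> /le_trans]; apply.
  rewrite natrM natrX exprD exprVn.
  have -> : (j%:R * 2 ^+ k + 1) / (2 ^+ k * 2 ^+ n) = j%:R / 2 ^+ n + 2 ^- k / 2 ^+ n :> R.
    by field; rewrite !gt_eqF.
  by rewrite lerD2l ler_piMr ?invr_ge0 ?(ltW (p2 _))// invf_le1// exprn_ege1// ler1n.
apply/eqP; rewrite eq_le; apply/andP; split; last by case/andP: (h 0%N).
apply/ler_addgt0Pr => e e0.
have [k /(_ k (leqnn k)) ke] := expr_lt_eventually (half_itv01 R) e0.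
by case/andP: (h k) => _ /le_trans; apply; rewrite lerD2l ltW.
Qed.

(** Points closer than the gap between stage-[n] intervals share one of them. *)
Lemma cantor_function_modulus n t t' : cantor_set g t -> cantor_set g t' ->
  `|t - t'| < (1 - 2 * g) * g ^+ n ->
  `|cantor_function g t - cantor_function g t'| <= 2^-1 ^+ n.
Proof.
move=> Ct Ct' tt'.
have [j _ jt] := (cantor_setP t).1 Ct n; have [j' _ jt'] := (cantor_setP t').1 Ct' n.
have jj' : j = j'.
  move: tt'; rewrite ltr_norml => tt'.
  by case: (ltngtP j j') => // /(cantor_left_gap n) h; exfalso; have := gX n; lra.
rewrite -jj' in jt'.
have := cantor_function_itv Ct jt; have := cantor_function_itv Ct' jt'.
by rewrite mulrDl mul1r exprVn => h1 h2; rewrite ler_norml; lra.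
Qed.

End cantor_geometry.

(** * Real-valued probabilities, finite unions, Bonferroni, independence *)

Section real_probability.
Context {d : measure_display} {T : measurableType d} {R : realType}.
Variable P : probability T R.
Implicit Types A E D : set T.

Definition pr A : R := fine (P A).

Lemma prE A : measurable A -> P A = (pr A)%:E.
Proof. by move=> mA; rewrite /pr fineK// fin_num_measure. Qed.

Lemma pr_ge0 A : 0 <= pr A.
Proof. by rewrite /pr fine_ge0. Qed.

Lemma pr_set0 : pr set0 = 0.
Proof. by rewrite /pr measure0. Qed.

Lemma pr_setT : pr setT = 1.
Proof. by rewrite /pr probability_setT. Qed.

Lemma pr_le A E : measurable A -> measurable E -> A `<=` E -> pr A <= pr E.
Proof. by move=> mA mE AE; rewrite -lee_fin -!prE// le_measure// inE. Qed.

Lemma pr_setDI A E : measurable A -> measurable E -> pr A = pr (A `\` E) + pr (A `&` E).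
Proof.
move=> mA mE; apply: EFin_inj; rewrite EFinD -!prE//.
- exact: measureDI.
- exact: measurableI.
- exact: measurableD.
Qed.

Lemma pr_setU A E : measurable A -> measurable E ->
  pr (A `|` E) = pr A + pr E - pr (A `&` E).
Proof.
move=> mA mE; have mU : measurable (A `|` E) by exact: measurableU.
rewrite (pr_setDI mU mA) (setIidr (@subsetUl _ A E)).
have -> : (A `|` E) `\` A = E `\` A.
  by apply/seteqP; split=> w /= [h nA]; split=> //; [case: h|right].
by rewrite (pr_setDI mE mA) setIC; ring.
Qed.

Lemma pr_setU_le A E : measurable A -> measurable E -> pr (A `|` E) <= pr A + pr E.
Proof. by move=> mA mE; rewrite pr_setU// lerBlDr lerDl pr_ge0. Qed.

Lemma pr_bigcup_cvg (F : nat -> set T) : (forall n, measurable (F n)) ->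
  nondecreasing_seq F -> pr (F n) @[n --> \oo] --> pr (\bigcup_n F n).
Proof.
move=> mF ndF; have mU : measurable (\bigcup_n F n) by exact: bigcup_measurable.
suff : (P \o F) @ \oo --> (pr (\bigcup_n F n))%:E by move/fine_cvg; exact.
rewrite -prE//.
exact: nondecreasing_cvg_mu.
Qed.

Lemma pr_bigcap_cvg (F : nat -> set T) : (forall n, measurable (F n)) ->
  nonincreasing_seq F -> pr (F n) @[n --> \oo] --> pr (\bigcap_n F n).
Proof.
move=> mF niF; have mI : measurable (\bigcap_n F n) by exact: bigcap_measurable.
suff : (P \o F) @ \oo --> (pr (\bigcap_n F n))%:E by move/fine_cvg; exact.
rewrite -prE//.
have F0 : (P (F 0%N) < +oo)%E by rewrite prE// ltry.
exact: nonincreasing_cvg_mu.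
Qed.

Section finite_unions.
Variable A : nat -> set T.
Hypothesis mA : forall n, measurable (A n).

Definition before (A' : nat -> set T) n : set T := \bigcup_(i in `I_n) A' i.

Definition first_hit (A' : nat -> set T) n : set T := A' n `\` before A' n.

Lemma measurable_before n : measurable (before A n).
Proof. exact: bigcup_measurable. Qed.

Lemma measurable_first_hit n : measurable (first_hit A n).
Proof. by apply: measurableD => //; exact: measurable_before. Qed.

Lemma before0 : before A 0 = set0.
Proof. by apply/seteqP; split=> w // [i]. Qed.

Lemma beforeS n : before A n.+1 = before A n `|` A n.
Proof.
apply/seteqP; split=> w.
  move=> [i /=]; rewrite ltnS leq_eqVlt => /orP[/eqP ->|lin Ai]; first by right.
  by left; exists i.
move=> [[i /= lin Ai]|An]; first by exists i => //=; exact: ltnW.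
by exists n => /=.
Qed.

Lemma pr_before_le n : pr (before A n) <= \sum_(i < n) pr (A i).
Proof.
elim: n => [|n ih]; first by rewrite before0 pr_set0 big_ord0.
rewrite beforeS big_ord_recr /= (le_trans (pr_setU_le _ _))//; first exact: measurable_before.
by rewrite lerD2r.
Qed.

(** The first-hit events partition [before A n]. *)
Lemma pr_before_first_hit n E : measurable E ->
  pr (before A n `&` E) = \sum_(i < n) pr (first_hit A i `&` E).
Proof.
move=> mE; elim: n => [|n ih]; first by rewrite before0 set0I pr_set0 big_ord0.
have mB := measurable_before.
rewrite big_ord_recr /= -ih beforeS.
rewrite (@pr_setDI _ (before A n)) //; last by apply: measurableI => //; exact: measurableU.
rewrite [LHS]addrC; congr (pr _ + pr _); apply/seteqP; split=> w.
- by move=> [[_ Ew] Bw]; split.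
- by move=> [Bw Ew]; split=> //; split=> //; left.
- by move=> [[[Bw|Aw] Ew] nB]; split.
- by move=> [[Aw nB] Ew]; split=> //; split=> //; right.
Qed.

End finite_unions.

Lemma before_setI (A : nat -> set T) n E : before A n `&` E = before (fun i => A i `&` E) n.
Proof. by rewrite /before setI_bigcupl. Qed.

(** Adding [A n] to the union gains its probability minus that of its overlap with the earlier
    events, and the union bound controls the overlap by pairs. *)
Lemma bonferroni (A : nat -> set T) n : (forall n, measurable (A n)) ->
  \sum_(j < n) pr (A j) - \sum_(j < n) \sum_(i < j) pr (A i `&` A j) <= pr (before A n).
Proof.
move=> mA; have mB := measurable_before mA.
elim: n => [|n ih]; first by rewrite before0 pr_set0 !big_ord0 subrr.
rewrite beforeS !big_ord_recr /= pr_setU//.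
have := @pr_before_le (fun i => A i `&` A n) (fun i => measurableI _ _ (mA i) (mA n)) n.
by rewrite -before_setI; lra.
Qed.

Lemma pr_bigcup_le (A : nat -> set T) c : (forall n, measurable (A n)) ->
  (forall n, \sum_(i < n) pr (A i) <= c) -> pr (\bigcup_n A n) <= c.
Proof.
move=> mA hc; have mB := measurable_before mA.
have -> : \bigcup_n A n = \bigcup_n before A n.
  apply/seteqP; split=> w [n _]; first by exists n.+1 => //; exists n => /=.
  by move=> [i _ Ai]; exists i.
have ndB : nondecreasing_seq (before A).
  move=> m n mn; apply/subsetPset => w [i /= im Ai]; exists i => //=.
  exact: leq_trans mn.
have cv := pr_bigcup_cvg mB ndB.
rewrite -(cvg_lim _ cv)//; apply: limr_le; first by apply/cvg_ex; eexists; exact: cv.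
by near=> n; apply: (le_trans (pr_before_le mA _)).
Unshelve. all: end_near. Qed.

Lemma pr_bigcap_ge (A : nat -> set T) c : (forall n, measurable (A n)) ->
  nonincreasing_seq A -> (forall n, c <= pr (A n)) -> c <= pr (\bigcap_n A n).
Proof.
move=> mA niA hc; have cv := pr_bigcap_cvg mA niA.
rewrite -(cvg_lim _ cv)//; apply: limr_ge; first by apply/cvg_ex; eexists; exact: cv.
by near=> n.
Unshelve. all: end_near. Qed.

Definition independent_of D := [set E | measurable E /\ pr (E `&` D) = pr E * pr D].

Lemma lambda_system_independent_of D : measurable D ->
  lambda_system setT (independent_of D).
Proof.
move=> mD; split=> //.
- by split=> //; rewrite setTI pr_setT mul1r.
- move=> A E EA [mA iA] [mE iE]; split; first exact: measurableD.
  have mAD := measurableI _ _ mA mD.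
  have := pr_setDI mA mE; have := pr_setDI mAD mE.
  have -> : A `&` D `\` E = (A `\` E) `&` D.
    by apply/seteqP; split=> w; [move=> [[]]|move=> [[]]].
  have -> : A `&` D `&` E = E `&` D.
    apply/seteqP; split=> w; first by move=> [[]].
    by move=> [Ew Dw]; split=> //; split=> //; exact: EA.
  rewrite (setIidr EA) iA iE => h1 h2.
  by rewrite (_ : pr (A `\` E) = pr A - pr E); [rewrite mulrBl; lra|lra].
- move=> F ndF hF; have mF n : measurable (F n) by case: (hF n).
  split; first exact: bigcup_measurable.
  have cv1 := pr_bigcup_cvg mF ndF.
  have mFD n : measurable (F n `&` D) by exact: measurableI.
  have ndFD : nondecreasing_seq (fun n => F n `&` D).
    by move=> m n mn; apply/subsetPset; apply: setSI; apply/subsetPset; exact: ndF.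
  have := pr_bigcup_cvg mFD ndFD.
  rewrite -setI_bigcupl; under eq_fun do rewrite (hF _).2.
  move=> cv2; apply: (cvg_unique _ cv2) => //; exact: cvgMl.
Qed.

(* Only the independence of [D] from finite rectangles is assumed: the rectangles form
   a pi-system that generates the sigma-algebra of [X 0, ..., X n]. *)
Lemma independent_of_rectangles n (X : nat -> T -> R) D : measurable D ->
  (forall i, measurable_fun setT (X i)) ->
  (forall V : nat -> set R, (forall i, measurable (V i)) ->
    independent_of D (\bigcap_(i in `I_n) (X i @^-1` V i))) ->
  forall E : set T,
    <<s [set E | exists2 V : nat -> set R, (forall i, measurable (V i)) &
                 E = \bigcap_(i in `I_n) (X i @^-1` V i)] >> E ->
    independent_of D E.
Proof.
move=> mD mX hr; apply: lambda_system_subset => //.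
- move=> _ _ [V mV ->] [W mW ->]; exists (fun i => V i `&` W i).
    by move=> i; exact: measurableI.
  apply/seteqP; split=> w.
    by move=> [h1 h2] i lin; split; [exact: h1|exact: h2].
  by move=> h; split=> i lin; case: (h i lin).
- exact: lambda_system_independent_of.
- by move=> _ [V mV ->]; exact: hr.
Qed.

End real_probability.

(** * Probabilities and independence of Brownian increments *)

Section brownian_windows.
Context {d : measure_display} {T : measurableType d} {R : realType}.
Variables (P : probability T R) (B : R -> {RV P >-> R}).
Hypothesis hB : standard_brownian_motion B.

(** Since [B] starts at [0], a position is an increment from time [0]; one notion thus serves both
    for hits and for jumps between hits. *)
Definition window (s t c e : R) : set T := [set w | `|B t w - B s w - c| <= e].

Lemma windowE s t c e : window s t c e = (fun w => B t w - B s w) @^-1` `[c - e, c + e].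
Proof. by apply/seteqP; split=> w; rewrite /window /= in_itv/= ler_distl. Qed.

Lemma measurable_increment s t : measurable_fun setT (fun w => B t w - B s w).
Proof. by apply: measurable_funB; exact: measurable_funP. Qed.

Lemma measurable_increment_preimage s t V : measurable V ->
  measurable ((fun w => B t w - B s w) @^-1` V).
Proof. by move=> mV; rewrite -[X in measurable X]setTI; exact: measurable_increment. Qed.

Lemma measurable_window s t c e : measurable (window s t c e).
Proof. by rewrite windowE; exact: measurable_increment_preimage. Qed.

Lemma pr_window_le s t c e w : 0 <= s -> s < t -> 0 <= e ->
  (forall x, `|x - c| <= e -> w <= x ^+ 2) ->
  pr P (window s t c e) <= 2 * e / Num.sqrt (t - s) * expR (- w / ((t - s) *+ 2)).
Proof.
move=> s0 st e0 hw; have ts0 : 0 < t - s by rewrite subr_gt0.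
rewrite -lee_fin -prE; last exact: measurable_window.
rewrite windowE (bm_normal_increments hB)//.
have ce : c - e <= c + e by lra.
have h x : c - e <= x <= c + e -> w <= x ^+ 2 by move=> hx; apply: hw; rewrite ler_distl.
have := normal_prob_itv_le (_ : 0 < Num.sqrt (t - s)) ce h.
rewrite sqr_sqrtr ?(ltW ts0)// sqrtr_gt0 => /(_ ts0).
by have -> : c + e - (c - e) = 2 * e by ring.
Qed.

Lemma pr_window_ge s t c e w : 0 <= s -> s < t -> 0 <= e ->
  (forall x, `|x - c| <= e -> x ^+ 2 <= w) ->
  2 * e / (3 * Num.sqrt (t - s)) * expR (- w / ((t - s) *+ 2)) <= pr P (window s t c e).
Proof.
move=> s0 st e0 hw; have ts0 : 0 < t - s by rewrite subr_gt0.
rewrite -lee_fin -prE; last exact: measurable_window.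
rewrite windowE (bm_normal_increments hB)//.
have ce : c - e <= c + e by lra.
have h x : c - e <= x <= c + e -> x ^+ 2 <= w by move=> hx; apply: hw; rewrite ler_distl.
have := normal_prob_itv_ge (_ : 0 < Num.sqrt (t - s)) ce h.
rewrite sqr_sqrtr ?(ltW ts0)// sqrtr_gt0 => /(_ ts0).
by have -> : c + e - (c - e) = 2 * e by ring.
Qed.

Definition big_increment (s t y : R) : set T := [set w | y < `|B t w - B s w|].

Lemma big_incrementE s t y :
  big_increment s t y = (fun w => B t w - B s w) @^-1` [set x : R | y < `|x|].
Proof. by []. Qed.

Lemma measurable_big_increment s t y : measurable (big_increment s t y).
Proof.
by rewrite big_incrementE; apply: measurable_increment_preimage; exact: measurable_norm_gt.
Qed.

Lemma pr_big_increment_le s t y : 0 <= s -> s <= t -> 0 < y ->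
  pr P (big_increment s t y) <= 128 * (t - s) ^+ 2 / y ^+ 4.
Proof.
move=> s0; rewrite le_eqVlt => /orP[/eqP <- y0|st y0].
  rewrite (_ : big_increment s s y = set0).
    by rewrite pr_set0 subrr expr0n mulr0 mul0r.
  by apply/seteqP; split=> w //=; rewrite /big_increment/= subrr normr0 ltNge ltW.
have ts0 : 0 < t - s by rewrite subr_gt0.
rewrite -lee_fin -prE; last exact: measurable_big_increment.
rewrite big_incrementE (bm_normal_increments hB)//; last exact: measurable_norm_gt.
apply: (le_trans (normal_prob_tail_inv4 _ y0)); first by rewrite sqrtr_gt0.
by rewrite lee_fin expr_div_n (exprM _ 2 2) sqr_sqrtr ?(ltW ts0)// mulrA.
Qed.

Lemma increments_independent n (t : nat -> R) (V : nat -> set R) :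
  0 <= t 0%N -> (forall i, t i <= t i.+1) -> (forall i, measurable (V i)) ->
  pr P (\bigcap_(i in `I_n) ((fun w => B (t i.+1) w - B (t i) w) @^-1` V i)) =
  \prod_(i < n) pr P ((fun w => B (t i.+1) w - B (t i) w) @^-1` V i).
Proof.
move=> t0 tS mV.
have := @bm_independent_increments _ _ _ _ _ hB n t t0 tS (fun i : 'I_n => V i) (fun i => mV i).
have -> : \bigcap_(i in [set: 'I_n]) ((fun w => B (t i.+1) w - B (t i) w) @^-1` V i) =
   \bigcap_(i in `I_n) ((fun w => B (t i.+1) w - B (t i) w) @^-1` V i).
  apply/seteqP; split=> w h i; first by move=> /= lin; exact: (h (Ordinal lin)).
  by move=> _; apply: h => /=; exact: ltn_ord.
have mI i : measurable ((fun w => B (t i.+1) w - B (t i) w) @^-1` V i).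
  exact: measurable_increment_preimage.
rewrite prE; last by apply: bigcap_measurableType => i _; exact: mI.
by under eq_bigr do rewrite prE//; rewrite prodEFin => -[].
Qed.

Lemma window_independent s t c e c' e' : 0 <= s -> s <= t ->
  pr P (window 0 s c e `&` window s t c' e') =
  pr P (window 0 s c e) * pr P (window s t c' e').
Proof.
move=> s0 st.
(* The default [t] keeps [tau] constant after its last entry, hence monotone. *)
pose tau i := nth t [:: 0; s; t] i.
pose V i := nth setT [:: `[c - e, c + e]%classic; `[c' - e', c' + e']%classic] i.
have tS i : tau i <= tau i.+1 by case: i => [|[|[|i]]] //; rewrite /tau /= ?nth_nil.
have mV i : measurable (V i) by case: i => [|[|i]]; rewrite /V /= ?nth_nil.
have := increments_independent 2 (lexx 0 : 0 <= tau 0%N) tS mV.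
rewrite !big_ord_recr big_ord0 /= mul1r -!windowE => <-; congr pr.
apply/seteqP; split=> w; rewrite !windowE.
  by move=> [h1 h2] [|[|]].
by move=> h; split; [exact: (h 0%N)|exact: (h 1%N)].
Qed.

(** The first-hit event depends only on increments up to time [a i], and the window only on the
    increment after it. Since the former is not a rectangle, the extension from rectangles to the
    generated sigma-algebra is needed. *)
Lemma first_hit_independent (a c : nat -> R) (e : R) i j c' e' :
  0 <= a 0%N -> (forall k, a k <= a k.+1) -> (i <= j)%N ->
  pr P (first_hit (fun k => window 0 (a k) (c k) e) i `&` window (a i) (a j) c' e') =
  pr P (first_hit (fun k => window 0 (a k) (c k) e) i) * pr P (window (a i) (a j) c' e').
Proof.
move=> a0 aS ij.
(* The times are [0, a 0, ..., a i] and then [a j] forever, so that [X i.+1] below is the increment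
   from [a i] to [a j]. *)
pose tau k := if k is l.+1 then (if (l <= i)%N then a l else a j) else 0.
have aij k l : (k <= l)%N -> a k <= a l.
  by move/subnK <-; elim: (l - k)%N => // q /le_trans; apply; rewrite addSn.
have tauS k : tau k <= tau k.+1.
  case: k => [|k] //=; case: (ltnP k i) => ki; first by rewrite ltnW.
  by case: ifP => // ki'; apply: aij; exact: leq_trans ij.
pose X k w := B (tau k.+1) w - B (tau k) w.
have mX k : measurable_fun setT (X k) by exact: measurable_increment.
have mXV k V : measurable V -> measurable (X k @^-1` V) by exact: measurable_increment_preimage.
have DE : window (a i) (a j) c' e' = X i.+1 @^-1` `[c' - e', c' + e'].
  by rewrite windowE /X /= leqnn ltnn.
have mD := measurable_window (a i) (a j) c' e'.
have := @independent_of_rectangles _ _ _ P i.+1 X _ mD mX.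
set G := [set E | exists2 V, _ & _] => hG.
suff : <<s G >> (first_hit (fun k => window 0 (a k) (c k) e) i).
  case/hG => // V mV.
  pose W k := if (k < i.+1)%N then V k else `[c' - e', c' + e']%classic.
  have WE : W i.+1 = `[c' - e', c' + e']%classic by rewrite /W ltnn.
  have mW k : measurable (W k) by rewrite /W; case: ifP.
  have h1 := increments_independent i.+1 (lexx 0 : 0 <= tau 0%N) tauS mV.
  have h2 := increments_independent i.+2 (lexx 0 : 0 <= tau 0%N) tauS mW.
  split; first by apply: bigcap_measurableType => k _; exact: mXV.
  transitivity (pr P (\bigcap_(k in `I_i.+2) (X k @^-1` W k))).
    rewrite DE; congr pr; apply/seteqP; split=> w.
      move=> [h3 h4] k /=; rewrite ltnS leq_eqVlt /W => /orP[/eqP ->|ki].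
        by rewrite ltnn.
      by rewrite ki; exact: h3.
    move=> h; split; last by have := h i.+1 (ltnSn _); rewrite /W ltnn.
    by move=> k /= ki; have := h k (ltnW ki); rewrite /W ki.
  rewrite DE [LHS]h2 [X in _ = X * _]h1 big_ord_recr /=.
  congr (_ * _); last by rewrite WE.
  by apply: eq_bigr => k _; rewrite /W ltn_ord.
(* It remains to see that the first hit is measurable for the sigma-algebra of [X 0, ..., X i]: each
   [B (a k)] with [k <= i] is a telescoping sum of these. *)
pose U := g_sigma_algebraType G.
have mXU k : (k <= i)%N -> measurable_fun (setT : set U) (X k : U -> R).
  move=> ki _ V mV; rewrite setTI; apply: sub_gen_smallest.
  exists (fun l => if l == k then V else setT); first by move=> l; case: eqP.
  apply/seteqP; split=> w; first by move=> Xw l /= li; case: eqP => // ->.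
  by move=> /(_ k); rewrite /= ltnS eqxx; exact.
have mBU k : (k <= i)%N -> measurable_fun (setT : set U) (fun w : U => B (a k) w - B 0 w).
  elim: k => [|k ih] ki; first by have := mXU 0%N (leq0n _).
  have -> : (fun w : U => B (a k.+1) w - B 0 w) = (fun w : U => (B (a k) w - B 0 w) + X k.+1 w).
    by apply/funext => w; rewrite /X /= ki ltnW//; ring.
  by apply: measurable_funD; [apply: ih; exact: ltnW|exact: mXU].
have mAU k : (k <= i)%N -> @measurable _ U (window 0 (a k) (c k) e).
  move=> ki; rewrite windowE -[X in measurable X]setTI; exact: mBU.
rewrite -[<<s G >>]/(@measurable _ U); apply: measurableD; first exact: mAU.
by apply: bigcup_measurable => k /= ki; apply: mAU; exact: ltnW.
Qed.

End brownian_windows.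

(** * The hitting event as a countable intersection of near hits *)

Section hitting_event.
Context {d : measure_display} {T : measurableType d} {R : realType}.
Variables (P : probability T R) (B : R -> {RV P >-> R}).
Hypothesis hB : standard_brownian_motion B.
Variable g : R.
Hypotheses (g0 : 0 < g) (g1 : g < 1 / 2).

Let g01 : 0 <= g < 1. Proof. by rewrite ltW//=; move: g1; lra. Qed.

Local Notation a := (cantor_left g).
Local Notation f := (cantor_function g).

Definition hit : set T :=
  [set w | zeros (fun t => B t w - cantor_function g t) `&` cantor_set g !=set0].

Definition near_hit (e : R) : set T :=
  \bigcup_n \bigcup_(j in `I_(2 ^ n)) window B 0 (a n j) (j%:R / 2 ^+ n) e.

Lemma measurable_near_hit e : measurable (near_hit e).
Proof.
apply: bigcup_measurable => n _; apply: bigcup_measurable => j _.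
exact: measurable_window.
Qed.

Lemma brownian_dist_lt w (t e : R) : 0 < t -> 0 < e ->
  exists2 del : R, 0 < del & forall t', `|t - t'| < del -> `|B t w - B t' w| < e.
Proof.
move=> t0 e0; have /continuous_within_itvcyP[+ _] := @bm_continuous_paths _ _ _ _ _ hB w.
move=> /(_ t); rewrite in_itv/= t0 => /(_ isT) /cvgrPdist_lt /(_ e e0).
by case=> del /= del0 h; exists del => // t' tt'; exact: h.
Qed.

Lemma cantor_set_ge1 t : cantor_set g t -> 1 <= t.
Proof.
move=> /(cantor_setP g0 g1) /(_ 0%N) [j _ /andP[+ _]]; apply: le_trans.
exact: cantor_left_ge1.
Qed.

Lemma cantor_set_le2 t : cantor_set g t -> t <= 2.
Proof.
move=> /(cantor_setP g0 g1) /(_ 0%N) [j j1 /andP[_ h]]; apply: le_trans h _.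
exact: cantor_left_le2.
Qed.

(** Points of the set within half a gap of [t] share one stage-[n] interval, and this interval is
    closed. *)
Lemma cantor_set_closed t :
  (forall e, 0 < e -> exists2 t', cantor_set g t' & `|t - t'| < e) -> cantor_set g t.
Proof.
move=> ht; apply/(cantor_setP g0 g1) => n.
have gn : 0 < (1 - 2 * g) * g ^+ n by rewrite mulr_gt0 ?exprn_gt0//; move: g1; lra.
have [t1 /(cantor_setP g0 g1)/(_ n)[j jn jt1] tt1] := ht _ (divr_gt0 gn (ltr0n _ 2)).
exists j => //.
have h e : 0 < e -> a n j - e <= t <= a n j + g ^+ n + e.
  move=> e0; pose e' := Num.min e ((1 - 2 * g) * g ^+ n / 2).
  have e'0 : 0 < e' by rewrite lt_min e0 divr_gt0.
  have e'e : e' <= e by rewrite ge_min lexx.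
  have e'g : e' <= (1 - 2 * g) * g ^+ n / 2 by rewrite ge_min lexx orbT.
  have [t2 /(cantor_setP g0 g1)/(_ n)[i _ it2] tt2] := ht _ e'0.
  have ij : i = j.
    move: tt1 tt2; rewrite !ltr_norml => tt1 tt2.
    have gn' : 0 < g ^+ n by rewrite exprn_gt0.
    by case: (ltngtP i j) => // /(cantor_left_gap g0 g1 n) h; exfalso; lra.
  by move: tt2; rewrite ltr_norml; rewrite ij in it2; lra.
apply/andP; split; apply/ler_addgt0Pr => e /h; lra.
Qed.

(** A hit is approximated by left endpoints of the intervals around it. Conversely, near hits
    cluster at a point of the closed Cantor set, where continuity of the path and of [f] on that set
    gives equality. Measurability of [hit] follows. *)
Lemma hitE : hit = \bigcap_m near_hit m.+1%:R^-1.
Proof.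
apply/seteqP; split=> w.
  move=> [t [[t0 /eqP]]]; rewrite subr_eq0 => /eqP Bt Ct m _.
  pose e : R := m.+1%:R^-1 / 2.
  have e0 : 0 < e by rewrite divr_gt0.
  have [del del0 hdel] := brownian_dist_lt w t0 e0.
  have [N1 hN1] := expr_lt_eventually (half_itv01 R) e0.
  have [N2 hN2] := expr_lt_eventually g01 del0.
  pose n := maxn N1 N2.
  have [j jn jt] := (cantor_setP g0 g1 t).1 Ct n.
  exists n => //; exists j => //; rewrite /window /= (bm_start hB) subr0.
  have ft := cantor_function_itv g0 g1 Ct jt.
  have := hN1 n (leq_maxl _ _); have := hN2 n (leq_maxr _ _).
  rewrite exprVn => h2 h1.
  have := hdel (a n j).
  rewrite ger0_norm; last by case/andP: jt; lra.
  move=> /(_ _)/wrap [|]; first by case/andP: jt; lra.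
  rewrite Bt; move: ft h1; rewrite mulrDl mul1r ltr_norml ler_norml /e.
  by move: (2 ^- n) (m.+1%:R^-1) (_ / 2 ^+ n) => x y z h3 h4 h5; lra.
move=> hw.
have /choice [tt htt] m : exists t, cantor_set g t /\ `|B t w - f t| <= m.+1%:R^-1.
  have [n _ [j /= jn]] := hw m I; rewrite /window /= (bm_start hB) subr0 => h.
  by exists (a n j); rewrite cantor_function_left//; split=> //; exact: cantor_left_in.
have [t [_ ct]] : `[1, 2]%classic `&` cluster (tt @ \oo) !=set0.
  apply: segment_compact; exists 0%N => // m _ /=; rewrite in_itv/=.
  by rewrite cantor_set_ge1 ?cantor_set_le2//; case: (htt m).
have {}ct e M : 0 < e -> exists2 m, (M <= m)%N & `|t - tt m| < e.
  move=> e0; have [||_ [[m Mm <-] h]] := ct (tt @` [set m | (M <= m)%N]) (ball t e).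
  - by exists M => // m Mm; exists m.
  - exact: nbhsx_ballx.
  by exists m.
have Ct : cantor_set g t.
  apply: cantor_set_closed => e e0; have [m _ h] := ct e 0%N e0.
  by exists (tt m) => //; case: (htt m).
have t0 : 0 < t by apply: lt_le_trans (cantor_set_ge1 Ct).
exists t; split=> //; split=> //; apply/eqP; rewrite -normr_le0.
apply/ler_addgt0Pr => e e0; rewrite add0r.
(* One third each for the path, for [f] and for the tolerance of the near hit. *)
have e30 : 0 < e / 3 by rewrite divr_gt0.
have [del del0 hdel] := brownian_dist_lt w t0 e30.
have [N hN] := expr_lt_eventually (half_itv01 R) e30.
have gn : 0 < (1 - 2 * g) * g ^+ N by rewrite mulr_gt0 ?exprn_gt0//; move: g1; lra.
have [M _ /(_ M (leqnn M)) hM] : \forall m \near \oo, m.+1%:R^-1 < e / 3 by exact: near_infty_natSinv_lt (PosNum e30).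
have [] := ct (Num.min del ((1 - 2 * g) * g ^+ N)) M; first by rewrite lt_min del0 gn.
move=> m Mm; rewrite lt_min => /andP[h1 h2].
have [Ctm Btm] := htt m.
have h3 := cantor_function_modulus g0 g1 Ct Ctm h2.
have h4 := hdel _ h1; have h5 := hN N (leqnn N).
have h6 : m.+1%:R^-1 <= M.+1%:R^-1 :> R by rewrite lef_pV2 ?posrE// ler_nat.
move: h3 h4 Btm h5 h6 hM; rewrite !ler_norml ltr_norml.
by move: (2^-1 ^+ N) (m.+1%:R^-1) (M.+1%:R^-1) => x y z ? ? ? ? ? ?; lra.
Qed.

Lemma measurable_hit : measurable hit.
Proof. by rewrite hitE; apply: bigcap_measurable => // m _; exact: measurable_near_hit. Qed.

Lemma pr_hit_ge c : (forall e, 0 < e -> c <= pr P (near_hit e)) -> c <= pr P hit.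
Proof.
move=> hc; rewrite hitE; apply: pr_bigcap_ge => [m|m n mn|m].
- exact: measurable_near_hit.
- apply/subsetPset => w [k _ [j jk h]]; exists k => //; exists j => //.
  by apply: (le_trans h); rewrite lef_pV2 ?posrE// ler_nat.
- by apply: hc; rewrite invr_gt0.
Qed.

End hitting_event.

(** * Sums over pairs of addresses *)

Section dyadic_sums.
Context {R : realType}.
Implicit Types (F p : nat -> nat -> R) (h : nat -> R).

Lemma sum_pairs_split F n :
  \sum_(x < n + n) \sum_(y < x) F y x =
  \sum_(x < n) \sum_(y < x) F y x + \sum_(x < n) \sum_(y < x) F (n + y)%N (n + x)%N +
  \sum_(x < n) \sum_(y < n) F y (n + x)%N.
Proof.
rewrite big_split_ord /= -addrA; congr (_ + _); rewrite -big_split /=.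
apply: eq_bigr => x _; rewrite big_split_ord /= addrC.
by congr (_ + _); apply: eq_bigr.
Qed.

(* A block of length [2 ^ L] splits into two halves; [kappa m] bounds the sum over the
   pairs that are separated by this split when the blocks have depth [m]. *)
Lemma dyadic_pairs_le p (kappa : nat -> R) N :
  (forall m l q, (l + m.+1 = N)%N ->
    \sum_(x < 2 ^ l) \sum_(y < 2 ^ l) p (q.*2 * 2 ^ l + y)%N (q.*2.+1 * 2 ^ l + x)%N
      <= kappa m) ->
  forall L m q, (L + m = N)%N ->
    \sum_(x < 2 ^ L) \sum_(y < x) p (q * 2 ^ L + y)%N (q * 2 ^ L + x)%N <=
    \sum_(l < L) 2 ^+ l * kappa (m + l)%N.
Proof.
move=> hk; elim=> [|L ih] m q LmN.
  by rewrite expn0 big_ord1 !big_ord0.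
have LmN' : (L + m.+1 = N)%N by rewrite addnS -addSn.
rewrite expnS mul2n -addnn.
set F := fun y x => p (q * (2 ^ L + 2 ^ L) + y)%N (q * (2 ^ L + 2 ^ L) + x)%N.
rewrite (sum_pairs_split F) /F big_ord_recl /= expr0 mul1r addn0.
have h1 := ih m.+1 q.*2 LmN'; have h2 := ih m.+1 q.*2.+1 LmN'.
have h3 := hk m L q LmN'.
have e1 : (q * (2 ^ L + 2 ^ L) = q.*2 * 2 ^ L)%N by rewrite addnn -muln2 -mul2n; ring.
have e2 x : (q * (2 ^ L + 2 ^ L) + (2 ^ L + x) = q.*2.+1 * 2 ^ L + x)%N.
  by rewrite e1 mulSn addnA [(2 ^ L + _)%N]addnC.
have -> : \sum_(i < L) 2 ^+ bump 0 i * kappa (m + bump 0 i)%N =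
          2 * \sum_(l < L) 2 ^+ l * kappa (m.+1 + l)%N.
  rewrite mulr_sumr; apply: eq_bigr => i _.
  by rewrite /bump /= add1n exprS mulrA addnS addSn.
rewrite -e1 in h1 h3.
under [X in _ + X + _ <= _]eq_bigr => x _ do under eq_bigr => y _ do rewrite !e2.
under [X in _ + _ + X <= _]eq_bigr => x _ do under eq_bigr => y _ do rewrite e2.
by lra.
Qed.

(** At most [k.+1] pairs have sum [k]. *)
Lemma sum_antidiagonals_le h n : (forall k, 0 <= h k) ->
  \sum_(x < n) \sum_(y < n) h (x + y)%N <= \sum_(k < n + n) k.+1%:R * h k.
Proof.
move=> h0.
have cnt m k : (\sum_(0 <= x < m) (x <= k)%N = minn m k.+1)%N.
  elim: m => [|m ih]; first by rewrite big_geq// min0n.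
  rewrite big_nat_recr //= ih; lia.
have row (x : 'I_n) : \sum_(y < n) h (x + y)%N <= \sum_(k < n + n) (x <= k)%:R * h k.
  have xn := ltnW (ltn_ord x).
  have -> : (n + n = x + (n + (n - x)))%N by rewrite addnCA subnKC.
  rewrite !big_split_ord /= -[leLHS]add0r lerD//.
    by apply: sumr_ge0 => k _; rewrite mulr_ge0.
  rewrite -[leLHS]addr0 lerD//; last by apply: sumr_ge0 => k _; rewrite mulr_ge0.
  by apply: ler_sum => k _; rewrite leq_addr mul1r.
apply: (le_trans (ler_sum _ (fun x _ => row x))).
rewrite exchange_big /=; apply: ler_sum => k _.
rewrite -mulr_suml ler_wpM2r// -natr_sum ler_nat.
rewrite -[X in (X <= _)%N](big_mkord xpredT (fun x => (x <= k : nat)%N)).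
by rewrite cnt geq_minr.
Qed.

(* With [u k = (1 + k (k + 1) c)^-1] the summand is at most [2 (u k - u (k + 1)) / c],
   by the inequality of arithmetic and geometric means. *)
Lemma sum_gauss_le (c : R) n : 0 < c ->
  \sum_(k < n) k.+1%:R * expR (- (k.+1%:R ^+ 2 * c)) <= 2 / c.
Proof.
move=> c0; pose u (k : nat) : R := (1 + k%:R * (k%:R + 1) * c)^-1.
have pos (k : nat) : 0 < 1 + k%:R * (k%:R + 1) * c.
  by rewrite ltr_pwDl// !mulr_ge0// ltW.
have hterm k : k.+1%:R * expR (- (k.+1%:R ^+ 2 * c)) <= 2 / c * (u k - u k.+1).
  have x0 : 0 <= k.+1%:R ^+ 2 * c by rewrite mulr_ge0 ?ltW// sqr_ge0.
  apply: (@le_trans _ _ (k.+1%:R * (4 / (1 + k.+1%:R ^+ 2 * c) ^+ 2))).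
    by rewrite ler_wpM2l// expRN_le_inv_sqr.
  have -> : 2 / c * (u k - u k.+1) =
      k.+1%:R * (4 / ((1 + k%:R * (k%:R + 1) * c) * (1 + k.+1%:R * (k.+1%:R + 1) * c))).
    rewrite /u; have := pos k; have := pos k.+1; rewrite -natr1 => p1 p2.
    by field; rewrite !gt_eqF.
  have sq0 : 0 < 1 + k.+1%:R ^+ 2 * c by lra.
  have p1 := pos k; have p2 := pos k.+1.
  rewrite ler_wpM2l// ler_wpM2l// lef_pV2 ?posrE ?mulr_gt0 ?exprn_gt0//.
  rewrite -natr1; have k0 : 0 <= k%:R :> R by [].
  move: (k%:R) k0 => z z0.
  rewrite -subr_ge0 (_ : _ - _ = (z + 1) ^+ 2 * c ^+ 2); last by ring.
  by rewrite mulr_ge0 ?sqr_ge0.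
apply: (@le_trans _ _ (\sum_(k < n) 2 / c * (u k - u k.+1))).
  by apply: ler_sum => k _; exact: hterm.
rewrite -mulr_sumr.
have -> : \sum_(k < n) (u k - u k.+1) = u 0%N - u n.
  elim: n => [|n ih]; first by rewrite big_ord0 subrr.
  by rewrite big_ord_recr /= ih; ring.
rewrite ler_piMr ?divr_ge0 ?(ltW c0)//.
have u0 : u 0%N = 1 by rewrite /u !mul0r addr0 invr1.
by rewrite u0 lerBlDr lerDl /u invr_ge0 ltW.
Qed.

Lemma sum_gauss_square_le (c : R) n : 0 < c ->
  \sum_(x < n) \sum_(y < n) expR (- ((n + x - y)%:R ^+ 2 * c)) <= 2 / c.
Proof.
move=> c0.
(* Reversing [y] turns [n + x - y] into [(x + y).+1]. *)
have -> : \sum_(x < n) \sum_(y < n) expR (- ((n + x - y)%:R ^+ 2 * c)) =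
    \sum_(x < n) \sum_(y < n) expR (- ((x + y).+1%:R ^+ 2 * c)).
  apply: eq_bigr => x _; rewrite (reindex_inj rev_ord_inj) /=.
  apply: eq_bigr => y _; congr (expR (- (_%:R ^+ 2 * c))).
  by have := ltn_ord y; lia.
apply: (le_trans (@sum_antidiagonals_le (fun k => expR (- (k.+1%:R ^+ 2 * c))) n _)).
  by move=> k; exact: expR_ge0.
exact: sum_gauss_le.
Qed.

End dyadic_sums.

(** * Positive probability when [g] differs from [1 / 4] *)

Section second_moment.
Context {d : measure_display} {T : measurableType d} {R : realType}.
Variables (P : probability T R) (B : R -> {RV P >-> R}).
Hypothesis hB : standard_brownian_motion B.

Lemma pr_window_le2 (t c e : R) : 1 <= t -> 0 <= e -> pr P (window B 0 t c e) <= 2 * e.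
Proof.
move=> t1 e0; have t0 : 0 < t by lra.
apply: (le_trans (pr_window_le (w := 0) hB _ t0 e0 _)) => //.
  by move=> x _; rewrite sqr_ge0.
rewrite subr0 oppr0 mul0r expR0 mulr1 ler_piMr ?mulr_ge0//.
by rewrite invf_le1 ?sqrtr_gt0// -ler_sqr ?nnegrE ?sqrtr_ge0// sqr_sqrtr ?expr1n// ltW.
Qed.

Variable g : R.
Hypotheses (g0 : 0 < g) (g1 : g < 1 / 2).

Local Notation a := (cantor_left g).
Local Notation A N eps := (fun i : nat => window B 0 (a N i) (i%:R / 2 ^+ N) (eps / 2 ^+ N)).

Let p2 k : 0 < (2 : R) ^+ k. Proof. by rewrite exprn_gt0. Qed.

Lemma pr_level_window_ge N i eps : (i < 2 ^ N)%N -> 0 <= eps <= 1 ->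
  eps / 2 ^+ N * (expR (- 2) / 3) <= pr P (A N eps i).
Proof.
move=> iN /andP[eps0 eps1].
have a1 := cantor_left_ge1 g0 g1 N i; have a2 := cantor_left_le2 g0 g1 iN.
have gN : 0 < g ^+ N by rewrite exprn_gt0.
set t := a N i in a1 a2 *.
have t0 : 0 < t by lra.
have e0 : 0 <= eps / 2 ^+ N by rewrite divr_ge0// ltW.
have e1 : eps / 2 ^+ N <= 1.
  by rewrite ler_pdivrMr// mul1r (le_trans eps1)// exprn_ege1// ler1n.
have i0 : 0 <= i%:R / 2 ^+ N :> R by rewrite divr_ge0// ltW.
have i1 : i%:R / 2 ^+ N <= 1 :> R.
  by rewrite ler_pdivrMr// mul1r -natrX ler_nat ltnW.
apply: le_trans; last first.
  (* Centre and radius are at most [1], so [x ^+ 2 <= 4]; as [1 <= t <= 2], the exponential is at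
     least [expR (- 2)] and the prefactor accounts for the [1 / 3]. *)
  apply: (pr_window_ge (w := 4) hB _ t0 e0) => //.
  move=> x; rewrite ler_norml; move: (eps / _) (i%:R / _) e0 e1 i0 i1 => e z *; nra.
have st2 : Num.sqrt t <= 2.
  by rewrite -ler_sqr ?nnegrE ?sqrtr_ge0// sqr_sqrtr ?(ltW t0)//; lra.
have st0 : 0 < Num.sqrt t by rewrite sqrtr_gt0.
rewrite subr0.
rewrite [leRHS](_ : _ = eps / 2 ^+ N * (expR (- 4 / (t *+ 2)) * (2 / (3 * Num.sqrt t)))); last by ring.
rewrite ler_wpM2l// ler_pM ?expR_ge0 ?invr_ge0//.
  rewrite ler_expR mulNr lerN2 ler_pdivrMr ?mulrn_wgt0//.
  by rewrite -mulr_natr; lra.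
by rewrite ler_pdivlMr ?mulr_gt0// ler_pdivrMl//; lra.
Qed.

(** Two hits force the increment between them into a window of doubled radius, independent of the
    first hit. The time elapsed is between [(1 - 2 * g) * g ^+ m] and [g ^+ m]: the lower bound
    controls the density's peak, the upper one its exponential. *)
Lemma pr_pair_le N m l q x y eps : (l + m.+1 = N)%N -> (x < 2 ^ l)%N -> (y < 2 ^ l)%N ->
  0 <= eps <= 1 / 4 ->
  pr P (A N eps (q.*2 * 2 ^ l + y)%N `&` A N eps (q.*2.+1 * 2 ^ l + x)%N) <=
  8 * (eps / 2 ^+ N) ^+ 2 / (Num.sqrt (1 - 2 * g) * Num.sqrt g ^+ m) *
  expR (- ((2 ^ l + x - y)%:R ^+ 2 * (8 * (2 ^+ N) ^+ 2 * g ^+ m)^-1)).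
Proof.
move=> lmN xl yl /andP[eps0 eps1].
set i := (q.*2 * _ + y)%N; set j := (q.*2.+1 * _ + x)%N; set k := (2 ^ l + x - y)%N.
have jE : (j = i + k)%N by rewrite /i /j /k; lia.
have k1 : (0 < k)%N by rewrite /k; lia.
have iq : (i %/ 2 ^ l = q.*2)%N by rewrite /i divnMDl ?expn_gt0// divn_small// addn0.
have jq : (j %/ 2 ^ l = q.*2.+1)%N by rewrite /j divnMDl ?expn_gt0// divn_small// addn0.
have := cantor_left_split g0 g1 m iq jq; rewrite lmN => /andP[tau1 tau2].
have ai := cantor_left_ge1 g0 g1 N i.
have g20 : 0 < 1 - 2 * g by move: g1; lra.
have gm : 0 < g ^+ m by rewrite exprn_gt0.
have tau0 : 0 < a N j - a N i by apply: lt_le_trans tau1; rewrite mulr_gt0.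
set e := eps / 2 ^+ N.
have e0 : 0 <= e by rewrite divr_ge0// ltW.
pose kD : R := k%:R / 2 ^+ N.
(* As [k >= 1] and [eps <= 1 / 4], the doubled radius [2 * e] is at most half the required jump
   [kD], so the increment is at least [kD / 2]. *)
have ekD : 4 * e <= kD.
  rewrite /e /kD mulrA ler_pM2r ?invr_gt0//.
  by apply: (@le_trans _ _ 1); [lra|rewrite ler1n].
have ai0 : 0 <= a N i by lra.
have aij : a N i < a N j by rewrite -subr_gt0.
apply: (@le_trans _ _ (pr P (A N eps i `&` window B (a N i) (a N j) kD (2 * e)))).
  apply: pr_le.
  - by apply: measurableI; exact: measurable_window.
  - by apply: measurableI; exact: measurable_window.
  move=> w [Ai Aj]; split=> //; move: Ai Aj; rewrite /window /= -/e !ler_norml.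
  rewrite jE natrD mulrDl -/kD.
  by move: (i%:R / _) (B _ w) (B (a N i) w) (B 0 w) => *; lra.
rewrite (window_independent hB _ _ _ _ ai0 (ltW aij)).
have h1 : pr P (A N eps i) <= 2 * e by exact: pr_window_le2.
have h2 : pr P (window B (a N i) (a N j) kD (2 * e)) <=
    2 * (2 * e) / Num.sqrt (a N j - a N i) *
    expR (- (kD ^+ 2 / 4) / ((a N j - a N i) *+ 2)).
  apply: (pr_window_le hB ai0 aij); first by rewrite mulr_ge0.
  by move=> z; rewrite ler_norml => hz; nra.
apply: (le_trans (ler_pM (pr_ge0 _ _) (pr_ge0 _ _) h1 h2)).
have b0 : 0 < Num.sqrt (1 - 2 * g) by rewrite sqrtr_gt0.
have s0 : 0 < Num.sqrt g ^+ m by rewrite exprn_gt0// sqrtr_gt0.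
have h3 : (Num.sqrt (a N j - a N i))^-1 <= (Num.sqrt (1 - 2 * g) * Num.sqrt g ^+ m)^-1.
  rewrite lef_pV2 ?posrE ?mulr_gt0 ?sqrtr_gt0//.
  rewrite -ler_sqr ?nnegrE ?sqrtr_ge0 ?mulr_ge0 ?(ltW b0) ?(ltW s0)// exprMn sqr_sqrtr ?(ltW g20)//.
  by rewrite exprAC !sqr_sqrtr ?(ltW g0) ?(ltW tau0).
have h4 : expR (- (kD ^+ 2 / 4) / ((a N j - a N i) *+ 2)) <=
    expR (- (k%:R ^+ 2 * (8 * (2 ^+ N) ^+ 2 * g ^+ m)^-1)).
  rewrite ler_expR mulNr lerN2.
  have -> : k%:R ^+ 2 * (8 * (2 ^+ N) ^+ 2 * g ^+ m)^-1 = kD ^+ 2 / 4 / (g ^+ m *+ 2).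
    by rewrite /kD; field; rewrite !gt_eqF.
  rewrite ler_wpM2l ?divr_ge0 ?sqr_ge0// lef_pV2 ?posrE ?mulrn_wgt0//.
  by rewrite ler_pMn2r.
rewrite (_ : 2 * e * _ = 8 * e ^+ 2 / Num.sqrt (a N j - a N i) *
   expR (- (kD ^+ 2 / 4) / ((a N j - a N i) *+ 2))); last by ring.
apply: ler_pM => //; rewrite ?expR_ge0//.
  by rewrite divr_ge0 ?sqrtr_ge0// mulr_ge0// sqr_ge0.
by rewrite ler_wpM2l// mulr_ge0// sqr_ge0.
Qed.

(** Both values of [rho] are valid for every [g]: the first comes from the Gaussian sum, with
    exactly the constant [128], the second from bounding the exponential by [1]. The tree has
    [2 ^ m] splits at depth [m], which cancels the [2] in [rho / 2]. *)
Lemma sum_pairs_cross_le N m l q eps rho : (l + m.+1 = N)%N -> 0 <= eps <= 1 / 4 ->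
  (rho = 2 * Num.sqrt g \/ rho = (2 * Num.sqrt g)^-1) ->
  \sum_(x < 2 ^ l) \sum_(y < 2 ^ l)
    pr P (A N eps (q.*2 * 2 ^ l + y)%N `&` A N eps (q.*2.+1 * 2 ^ l + x)%N) <=
  128 * eps ^+ 2 / Num.sqrt (1 - 2 * g) * (rho / 2) ^+ m.
Proof.
move=> lmN heps hrho.
set C := 8 * (eps / 2 ^+ N) ^+ 2 / (Num.sqrt (1 - 2 * g) * Num.sqrt g ^+ m).
set c := (8 * (2 ^+ N) ^+ 2 * g ^+ m)^-1.
have gm : 0 < g ^+ m by rewrite exprn_gt0.
have c0 : 0 < c by rewrite invr_gt0 !mulr_gt0 ?exprn_gt0.
have g20 : 0 < 1 - 2 * g by move: g1; lra.
have s0 : 0 < Num.sqrt g by rewrite sqrtr_gt0.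
have b0 : 0 < Num.sqrt (1 - 2 * g) by rewrite sqrtr_gt0.
have C0 : 0 <= C.
  by apply: divr_ge0; rewrite mulr_ge0 ?sqr_ge0 ?exprn_ge0 ?sqrtr_ge0.
have sum_le : \sum_(x < 2 ^ l) \sum_(y < 2 ^ l)
    pr P (A N eps (q.*2 * 2 ^ l + y)%N `&` A N eps (q.*2.+1 * 2 ^ l + x)%N) <=
  C * \sum_(x < 2 ^ l) \sum_(y < 2 ^ l) expR (- ((2 ^ l + x - y)%:R ^+ 2 * c)).
  rewrite mulr_sumr; apply: ler_sum => x _; rewrite mulr_sumr; apply: ler_sum => y _.
  exact: pr_pair_le.
apply: (le_trans sum_le).
have NE : (2 : R) ^+ N = 2 ^+ l * (2 * 2 ^+ m) by rewrite -exprS -exprD lmN.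
have gE : g ^+ m = (Num.sqrt g ^+ m) ^+ 2 by rewrite exprAC sqr_sqrtr// ltW.
have sm0 : 0 < Num.sqrt g ^+ m by rewrite exprn_gt0.
have pm := p2 m; have pl := p2 l.
case: hrho => ->.
  apply: (@le_trans _ _ (C * (2 / c))).
    by rewrite ler_wpM2l// sum_gauss_square_le.
  rewrite le_eqVlt; apply/orP; left; apply/eqP.
  have -> : (2 * Num.sqrt g / 2) ^+ m = Num.sqrt g ^+ m by congr (_ ^+ m); field.
  by rewrite /C /c invrK gE; field; rewrite !gt_eqF.
apply: (@le_trans _ _ (C * ((2 ^+ l) ^+ 2))).
  rewrite ler_wpM2l//.
  apply: (@le_trans _ _ (\sum_(x < 2 ^ l) \sum_(y < 2 ^ l) 1)).
    apply: ler_sum => x _; apply: ler_sum => y _.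
    by rewrite -expR0 ler_expR oppr_le0 mulr_ge0 ?sqr_ge0// ltW.
  by rewrite !sumr_const !card_ord -mulrnA -natrX -natrX ler_nat mulnn.
have -> : ((2 * Num.sqrt g)^-1 / 2) ^+ m = (Num.sqrt g ^+ m)^-1 / (2 ^+ m) ^+ 2.
  by rewrite expr_div_n exprVn exprMn; field; rewrite !gt_eqF.
rewrite /C NE.
have E0 : 0 <= eps ^+ 2 / Num.sqrt (1 - 2 * g) / Num.sqrt g ^+ m / (2 ^+ m) ^+ 2.
  by rewrite !divr_ge0 ?sqr_ge0// ltW.
rewrite [leLHS](_ : _ = 2 * (eps ^+ 2 / Num.sqrt (1 - 2 * g) / Num.sqrt g ^+ m / (2 ^+ m) ^+ 2)); last first.
  by field; rewrite !gt_eqF.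
rewrite [leRHS](_ : _ = 128 * (eps ^+ 2 / Num.sqrt (1 - 2 * g) / Num.sqrt g ^+ m / (2 ^+ m) ^+ 2)); last first.
  by field; rewrite !gt_eqF.
by rewrite ler_wpM2r// ler_nat.
Qed.

Lemma before_near_hit N eps e : eps / 2 ^+ N <= e ->
  before (A N eps) (2 ^ N) `<=` near_hit B g e.
Proof.
move=> he w [i iN Ai]; exists N => //; exists i => //.
exact: le_trans he.
Qed.

Lemma pr_hit_gt0 : g != 1 / 4 -> 0 < pr P (hit B g).
Proof.
move=> g14.
have s0 : 0 < Num.sqrt g by rewrite sqrtr_gt0.
have s2 : Num.sqrt g ^+ 2 = g by rewrite sqr_sqrtr// ltW.
have [rho rhoE rho01] : exists2 rho : R,
    rho = 2 * Num.sqrt g \/ rho = (2 * Num.sqrt g)^-1 & 0 <= rho < 1.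
  case: (ltgtP g (1 / 4)) => [h|h|h]; last by rewrite h eqxx in g14.
    by exists (2 * Num.sqrt g); [left|nra].
  exists (2 * Num.sqrt g)^-1; first by right.
  by rewrite invr_ge0 mulr_ge0 ?(ltW s0)//= invf_lt1 ?mulr_gt0//; nra.
have g20 : 0 < 1 - 2 * g by move: g1; lra.
have b0 : 0 < Num.sqrt (1 - 2 * g) by rewrite sqrtr_gt0.
pose K := 128 / Num.sqrt (1 - 2 * g) / (1 - rho).
pose c : R := expR (- 2) / 3.
have K0 : 0 < K by rewrite !divr_gt0//; lra.
have c0 : 0 < c by rewrite divr_gt0 ?expR_gt0.
(* With this choice [K * eps ^+ 2 <= c * eps / 2], so the pairs cost at most half of the first-order
   sum. *)
pose eps := Num.min (1 / 4) (c / (2 * K)).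
have eps0 : 0 < eps by rewrite lt_min !divr_gt0// mulr_gt0.
have eps1 : eps <= 1 / 4 by rewrite ge_min lexx.
have epsK : eps * (2 * K) <= c.
  have K20 : 0 < 2 * K by rewrite mulr_gt0.
  by rewrite -(ler_pdivlMr _ _ K20) /eps ge_min lexx orbT.
suff : c * eps / 2 <= pr P (hit B g).
  by apply: lt_le_trans; rewrite divr_gt0// mulr_gt0.
apply: pr_hit_ge => // e e0.
have [N /(_ N (leqnn N)) hN] := expr_lt_eventually (half_itv01 R) e0.
have eN : eps / 2 ^+ N <= e.
  rewrite -exprVn; apply: le_trans (ltW hN); rewrite ler_piMl ?exprn_ge0//; lra.
have mA i : measurable (A N eps i) by exact: measurable_window.
apply: (@le_trans _ _ (pr P (before (A N eps) (2 ^ N)))); last first.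
  apply: pr_le; [exact: measurable_before|exact: measurable_near_hit|].
  exact: before_near_hit.
apply: (le_trans _ (bonferroni P _ mA)).
have first : c * eps <= \sum_(j < 2 ^ N) pr P (A N eps j).
  rewrite (_ : c * eps = \sum_(j < 2 ^ N) eps / 2 ^+ N * c).
    apply: ler_sum => j _; apply: pr_level_window_ge => //; lra.
  by rewrite sumr_const card_ord -[RHS]mulr_natr natrX; field; rewrite gt_eqF.
have eps01 : 0 <= eps <= 1 / 4 by rewrite ltW.
have second : \sum_(j < 2 ^ N) \sum_(i < j) pr P (A N eps i `&` A N eps j) <= K * eps ^+ 2.
  have := @dyadic_pairs_le _ (fun i j => pr P (A N eps i `&` A N eps j)) _ N
    (fun m l q lm => sum_pairs_cross_le q lm eps01 rhoE) N 0 0 (addn0 N).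
  rewrite mul0n /= => /le_trans; apply.
  rewrite (eq_bigr (fun l : 'I_N => 128 * eps ^+ 2 / Num.sqrt (1 - 2 * g) * rho ^+ l)); last first.
    move=> l _; rewrite add0n expr_div_n mulrCA; congr (_ * _).
    by rewrite mulrC divfK// gt_eqF.
  rewrite -mulr_sumr.
  rewrite (_ : K * eps ^+ 2 = 128 * eps ^+ 2 / Num.sqrt (1 - 2 * g) * (1 - rho)^-1); last first.
    by rewrite /K; ring.
  by rewrite ler_wpM2l ?sum_expr_le// divr_ge0 ?sqrtr_ge0// mulr_ge0// sqr_ge0.
by nra.
Qed.

End second_moment.

(** * Counting zero digits of addresses *)

Section zero_bits.
Context {R : realType}.

(** Positions are counted from the least significant digit; at depth [n = 3 r] the condition
    [r <= l] selects the [2 r] leading digits. *)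
Definition zero_bits (r n i : nat) : nat := \sum_(l < n) ((r <= l) && ~~ odd (i %/ 2 ^ l))%N.

Lemma zero_bitsS r n i :
  zero_bits r n.+1 i = (zero_bits r n i + ((r <= n) && ~~ odd (i %/ 2 ^ n)))%N.
Proof. by rewrite /zero_bits big_ord_recr. Qed.

(** A zero digit of [i] at position [l] has a sibling block of [2 ^ l] later addresses, which
    contributes at least [c]. Blocks for different [l] are disjoint: the sum stops at the end of the
    block of length [2 ^ n] around [i], and a new zero digit appends the next block. *)
Lemma sum_zero_bits_ge (p : nat -> R) (c : R) r i n : (forall j, 0 <= p j) ->
  (forall l j, (r <= l < n)%N -> ~~ odd (i %/ 2 ^ l)%N -> (j %/ 2 ^ l = (i %/ 2 ^ l).+1)%N ->
    c / 2 ^+ l <= p j) ->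
  c * (zero_bits r n i)%:R <= \sum_(j < (i %/ 2 ^ n).+1 * 2 ^ n) (i < j)%N%:R * p j.
Proof.
move=> p0; elim: n => [|n ih] hp.
  by rewrite /zero_bits big_ord0 mulr0; apply: sumr_ge0 => j _; rewrite mulr_ge0.
have {}ih : c * (zero_bits r n i)%:R <= \sum_(j < (i %/ 2 ^ n).+1 * 2 ^ n) (i < j)%N%:R * p j.
  by apply: ih => l j /andP[rl ln]; apply: hp; rewrite rl ltnW.
set q := (i %/ 2 ^ n)%N in ih hp *.
have qE : (i %/ 2 ^ n.+1 = q./2)%N by rewrite expnSr divnMA divn2.
rewrite zero_bitsS -/q qE natrD mulrDr.
have [qo|qe] := boolP (odd q).
  rewrite andbF mulr0 addr0.
  have -> : (q./2.+1 * 2 ^ n.+1 = q.+1 * 2 ^ n)%N by rewrite expnS; lia.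
  exact: ih.
have -> : (q./2.+1 * 2 ^ n.+1 = q.+1 * 2 ^ n + 2 ^ n)%N by rewrite expnS; lia.
rewrite big_split_ord /= lerD//.
have iq : (i < q.+1 * 2 ^ n)%N by rewrite ltn_ceil ?expn_gt0.
have [rn|rn] := leqP r n; last first.
  by rewrite mulr0; apply: sumr_ge0 => j _; rewrite mulr_ge0.
rewrite (_ : c * _ = \sum_(x < 2 ^ n) c / 2 ^+ n); last first.
  have e2 : (2 : R) ^+ n != 0 by rewrite expf_neq0.
  by rewrite sumr_const card_ord -[RHS]mulr_natr natrX divfK// mulr1.
apply: ler_sum => x _; rewrite (leq_trans iq) ?leq_addr// mul1r; apply: hp => //.
- by rewrite rn ltnSn.
- by rewrite divnMDl ?expn_gt0// divn_small// addn0.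
Qed.

(** The weight is a product over digits: each of the [r] low digits contributes [2], each of the [k]
    others [1 + x]. *)
Lemma sum_zero_bits_weight (x : R) r k :
  \sum_(i < 2 ^ (k + r)) x ^+ zero_bits r (k + r) i = 2 ^+ r * (1 + x) ^+ k.
Proof.
elim: k => [|k ih].
  rewrite add0n expr0 mulr1 (eq_bigr (fun=> 1)) => [|i _].
    by rewrite sumr_const card_ord natrX.
  rewrite /zero_bits big1 ?expr0// => l _.
  by rewrite leqNgt ltn_ord.
rewrite addSn expnS mul2n -addnn big_split_ord /= exprS.
rewrite (_ : 2 ^+ r * ((1 + x) * (1 + x) ^+ k) = x * (2 ^+ r * (1 + x) ^+ k) + 2 ^+ r * (1 + x) ^+ k); last by ring.
rewrite -ih mulr_sumr; congr (_ + _); apply: eq_bigr => i _; rewrite zero_bitsS leq_addl /=.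
  by rewrite divn_small// addn1 exprS.
(* In the upper half the leading digit is one, and the lower digits are unchanged. *)
rewrite divnDl ?dvdnn// divnn expn_gt0/= divn_small//= addn0; congr (_ ^+ _).
apply: eq_bigr => l _; rewrite divnDl ?dvdn_exp2l ?(ltnW (ltn_ord l))//.
rewrite oddD -expnB ?(ltnW (ltn_ord l))// oddX orbF.
by have -> : (k + r - l == 0)%N = false by rewrite subn_eq0 leqNgt ltn_ord.
Qed.

End zero_bits.

(** * Probability zero at the critical value [1 / 4] *)

Section quarter.
Context {d : measure_display} {T : measurableType d} {R : realType}.
Variables (P : probability T R) (B : R -> {RV P >-> R}).
Hypothesis hB : standard_brownian_motion B.

Local Notation g := (1 / 4 : R).
Local Notation a := (cantor_left g).

Let g0 : 0 < g. Proof. by lra. Qed.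
Let g1 : g < 1 / 2. Proof. by lra. Qed.
Let p2 k : 0 < (2 : R) ^+ k. Proof. by rewrite exprn_gt0. Qed.

Let gX k : g ^+ k = (2 ^+ k) ^- 2.
Proof. by rewrite expr_div_n expr1n -exprM -natrX mulnC expnM natrX mul1r. Qed.

(* The tolerance [theta r = 2 ^- (2 r)] is the Brownian scale at depth [2 r]; the grid is
   [r] levels deeper, which makes oscillations between its points negligible. *)
Local Notation dep r := (r.*2 + r)%N.
Local Notation theta r := (g ^+ r).
Local Notation A r := (fun i : nat => window B 0 (a (dep r) i) (i%:R / 2 ^+ dep r) (theta r)).

Let depE r : (2 : R) ^+ dep r = (2 ^+ r) ^+ 3.
Proof. by rewrite -exprM; congr (_ ^+ _); lia. Qed.

(** Here criticality enters: the elapsed time is of order [4 ^- m], so the standard deviation is of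
    order [2 ^- m], and the jump is at most [2 ^- m] as well. Hence the Gaussian factor is bounded
    below. The condition [r <= l] makes [theta r] at most [2 ^- m]. *)
Lemma pr_increment_window_ge r i j l m : (l + m.+1 = dep r)%N -> (r <= l)%N ->
  ~~ odd (i %/ 2 ^ l)%N -> (j %/ 2 ^ l = (i %/ 2 ^ l).+1)%N ->
  expR (- 4) / 3 * 2 ^+ r / 2 ^+ l <=
  pr P (window B (a (dep r) i) (a (dep r) j) ((j%:R - i%:R) / 2 ^+ dep r) (theta r)).
Proof.
move=> lm rl; set q := (i %/ 2 ^ l)%N => qe jq.
have qE : (i %/ 2 ^ l = (q./2).*2)%N by rewrite halfK (negbTE qe) subn0.
have jE : (j %/ 2 ^ l = (q./2).*2.+1)%N by rewrite jq halfK (negbTE qe) subn0.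
have mr : (m <= r * 2)%N by move: lm rl; clear; lia.
have l0 : (0 < 2 ^ l)%N by rewrite expn_gt0.
have := leq_trunc_div i (2 ^ l); have := ltn_ceil i l0.
have := leq_trunc_div j (2 ^ l); have := ltn_ceil j l0.
rewrite jq -/q => j2 j1 i2 i1.
have ij : (i <= j)%N by move: i2 j1; clear; lia.
have ji : (j <= 2 * 2 ^ l + i)%N by move: i1 j2; rewrite !mulSn; clear; lia.
have := cantor_left_split g0 g1 m qE jE; rewrite lm => /andP[tau1 tau2].
set n := dep r in lm tau1 tau2 *; set tau := a n j - a n i in tau1 tau2.
have gm : 0 < g ^+ m by rewrite exprn_gt0.
have tau0 : 0 < tau by lra.
have aij : a n i < a n j by rewrite -subr_gt0.
have ai : 0 <= a n i by apply: le_trans (cantor_left_ge1 g0 g1 n i).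
have th0 : 0 < theta r by rewrite exprn_gt0.
have pm := p2 m; have pl := p2 l; have pr0 := p2 r.
have nE : (2 : R) ^+ n = 2 ^+ l * (2 * 2 ^+ m) by rewrite -exprS -exprD lm.
have thm : theta r <= (2 ^+ m)^-1.
  by rewrite gX lef_pV2 ?posrE ?exprn_gt0// -exprM ler_weXn2l// ler1n.
have k0 : 0 <= (j%:R - i%:R) / 2 ^+ n :> R.
  by rewrite divr_ge0 ?(ltW (p2 _))// subr_ge0 ler_nat.
have k1 : (j%:R - i%:R) / 2 ^+ n <= (2 ^+ m)^-1 :> R.
  rewrite nE ler_pdivrMr ?mulr_gt0// (_ : _^-1 * _ = 2 * 2 ^+ l); last by field; rewrite gt_eqF.
  by rewrite lerBlDr -natrX -natrM -natrD ler_nat.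
apply: (@le_trans _ _ (2 * theta r / (3 * Num.sqrt tau) * expR (- (4 * g ^+ m) / (tau *+ 2)))); last first.
  apply: (pr_window_ge (w := 4 * g ^+ m) hB ai aij (ltW th0)).
  have -> : g ^+ m = (2 ^+ m)^-1 ^+ 2 by rewrite gX exprVn.
  move=> x; rewrite ler_norml.
  move: ((2 ^+ m)^-1) (_ / 2 ^+ n) (theta r) th0 thm k0 k1 => z y e *.
  have h1 : 0 <= 2 * z - x by lra.
  have h2 : 0 <= 2 * z + x by lra.
  by nra.
have st : Num.sqrt tau <= (2 ^+ m)^-1.
  rewrite -ler_sqr ?nnegrE ?sqrtr_ge0 ?invr_ge0 ?(ltW pm)// sqr_sqrtr ?(ltW tau0)//.
  by rewrite exprVn -gX.
have st0 : 0 < Num.sqrt tau by rewrite sqrtr_gt0.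
have h1 : expR (- 4) <= expR (- (4 * g ^+ m) / (tau *+ 2)).
  rewrite ler_expR mulNr lerN2 ler_pdivrMr ?mulrn_wgt0//.
  by move: (g ^+ m) tau1 => z tau1; lra.
have h2 : 2 * theta r / (3 * (2 ^+ m)^-1) <= 2 * theta r / (3 * Num.sqrt tau).
  by rewrite ler_wpM2l ?mulr_ge0 ?(ltW th0)// lef_pV2 ?posrE ?mulr_gt0 ?invr_gt0// ler_wpM2l.
apply: (le_trans _ (ler_pM _ (expR_ge0 _) h2 h1)); last first.
  by rewrite divr_ge0 ?mulr_ge0 ?invr_ge0 ?(ltW th0) ?(ltW pm).
rewrite le_eqVlt; apply/orP; left; apply/eqP.
have -> : (2 : R) ^+ r = 2 ^+ n * theta r.
  by rewrite depE gX; field; rewrite gt_eqF.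
by rewrite nE; field; rewrite !gt_eqF.
Qed.

(** A first hit at [i] followed by the matching increment puts [B] in the doubled window at [j].
    First hits are disjoint, so the sum is at most the probability of that window. *)
Lemma pr_first_hit_sum_le r j :
  \sum_(i < j) pr P (first_hit (A r) i) *
    pr P (window B (a (dep r) i) (a (dep r) j) ((j%:R - i%:R) / 2 ^+ dep r) (theta r)) <=
  4 * theta r.
Proof.
set n := dep r; have mA i : measurable (A r i) by exact: measurable_window.
have th0 : 0 < theta r by rewrite exprn_gt0.
pose A' := window B 0 (a n j) (j%:R / 2 ^+ n) (2 * theta r).
have mA' : measurable A' by exact: measurable_window.
apply: (@le_trans _ _ (pr P A')); last first.
  rewrite (_ : 4 * theta r = 2 * (2 * theta r)); last by ring.
  apply: (pr_window_le2 hB); first exact: cantor_left_ge1.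
  by rewrite mulr_ge0// ltW.
apply: (@le_trans _ _ (pr P (before (A r) j `&` A'))); last first.
  by apply: pr_le => //; apply: measurableI => //; exact: measurable_before.
rewrite pr_before_first_hit//; apply: ler_sum => i _.
have a0 : 0 <= a n 0 by apply: le_trans (cantor_left_ge1 g0 g1 n 0).
have aS k : a n k <= a n k.+1.
  rewrite -subr_ge0; apply: le_trans (cantor_left_gap g0 g1 n (ltnSn k)).
  by rewrite mulr_ge0 ?exprn_ge0//; lra.
rewrite -(first_hit_independent hB _ _ _ _ a0 aS (ltnW (ltn_ord i))).
apply: pr_le.
- by apply: measurableI; [exact: measurable_first_hit|exact: measurable_window].
- by apply: measurableI => //; exact: measurable_first_hit.
move=> w [Fi Di]; split=> //; case: Fi => Ai _; move: Ai Di.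
rewrite /A' /window /= -/n !ler_norml mulrBl.
by move: (i%:R / _) (j%:R / _) (B _ w) (B (a n i) w) (B 0 w) => *; lra.
Qed.

(** Sum the previous bound over [j] and exchange the sums. Each zero digit is worth
    [c = expR (- 4) / 3 * 2 ^+ r], the total is at most [2 ^+ dep r * (4 * theta r) = 4 * 2 ^+ r],
    and the quotient is [12 * expR 4]. *)
Lemma sum_zero_bits_first_hit_le r :
  \sum_(i < 2 ^ dep r) (zero_bits r (dep r) i)%:R * pr P (first_hit (A r) i) <= 12 * expR 4.
Proof.
set n := dep r; have mA i : measurable (A r i) by exact: measurable_window.
pose p i j := pr P (window B (a n i) (a n j) ((j%:R - i%:R) / 2 ^+ n) (theta r)).
pose c : R := expR (- 4) / 3 * 2 ^+ r.
have c0 : 0 < c by rewrite mulr_gt0 ?divr_gt0 ?expR_gt0.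
have zle (i : 'I_(2 ^ n)) :
    c * (zero_bits r n i)%:R <= \sum_(j < 2 ^ n) (i < j)%N%:R * p i j.
  have h := @sum_zero_bits_ge _ (p i) c r i n (fun j => pr_ge0 P _).
  have iE : ((i %/ 2 ^ n).+1 * 2 ^ n = 2 ^ n)%N by rewrite divn_small ?mul1n.
  rewrite iE in h; apply: h => l j /andP[rl ln] ie jE.
  apply: (@pr_increment_window_ge r i j l (n - l.+1)) => //.
  by rewrite addnS -addSn subnKC.
have key : \sum_(i < 2 ^ n) c * (zero_bits r n i)%:R * pr P (first_hit (A r) i) <=
    2 ^+ n * (4 * theta r).
  apply: (@le_trans _ _ (\sum_(i < 2 ^ n) \sum_(j < 2 ^ n)
      (i < j)%N%:R * p i j * pr P (first_hit (A r) i))).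
    by apply: ler_sum => i _; rewrite -mulr_suml ler_wpM2r ?pr_ge0.
  rewrite exchange_big /= (_ : 2 ^+ n * (4 * theta r) = \sum_(j < 2 ^ n) 4 * theta r); last first.
    by rewrite sumr_const card_ord -[RHS]mulr_natr natrX mulrC.
  apply: ler_sum => j _; apply: le_trans (pr_first_hit_sum_le r j).
  rewrite -/n (big_ord_widen _ (fun i => pr P (first_hit (A r) i) * p i j) (ltnW (ltn_ord j))).
  rewrite [leRHS]big_mkcond /=; apply: ler_sum => i _.
  by case: (ltnP i j) => _; [rewrite (mul1r (p i j)) mulrC|rewrite !mul0r].
rewrite -(ler_pM2l c0) mulr_sumr.
rewrite (eq_bigr (fun i : 'I_(2 ^ n) => c * (zero_bits r n i)%:R * pr P (first_hit (A r) i))); last first.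
  by move=> i _; rewrite mulrA.
apply: (le_trans key); rewrite le_eqVlt; apply/orP; left; apply/eqP.
have eE : expR (- 4) = (expR 4)^-1 :> R by rewrite expRN.
have e4 : expR 4 != 0 :> R by rewrite gt_eqF ?expR_gt0.
by rewrite /c eE depE gX; have := p2 r => pr0; field; rewrite e4 gt_eqF.
Qed.

(** Markov's inequality treats first hits at addresses with at least [K] zero digits. For the others
    the weight [8 ^ (K - zeros)] is at least [1]; summing it gives [(9 / 8) ^ (2 r) * 2 ^ r * 4 ^ (-
    r) = (81 / 128) ^ r] up to the constant factor. *)
Lemma pr_before_quarter_le r K : (0 < K)%N ->
  pr P (before (A r) (2 ^ dep r)) <= 12 * expR 4 / K%:R + 2 * 8 ^+ K * (81 / 128) ^+ r.
Proof.
move=> K0; set n := dep r; have mA i : measurable (A r i) by exact: measurable_window.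
have th0 : 0 < theta r by rewrite exprn_gt0.
have := pr_before_first_hit P mA (2 ^ n) measurableT; rewrite setIT => ->.
have e80 : 0 <= (8 : R)^-1 <= 1 by lra.
apply: (@le_trans _ _ (\sum_(i < 2 ^ n)
   ((zero_bits r n i)%:R * pr P (first_hit (A r) i) / K%:R +
    2 * theta r * 8 ^+ K * (8^-1 ^+ zero_bits r n i)))).
  apply: ler_sum => i _; rewrite setIT.
  have f0 := pr_ge0 P (first_hit (A r) i).
  have K0' : 0 < K%:R :> R by rewrite ltr0n.
  have [zK|zK] := leqP K (zero_bits r n i).
    apply: (@le_trans _ _ ((zero_bits r n i)%:R * pr P (first_hit (A r) i) / K%:R)).
      by rewrite ler_pdivlMr// mulrC ler_wpM2r// ler_nat.
    by rewrite lerDl !mulr_ge0 ?exprn_ge0 ?(ltW th0).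
  apply: (@le_trans _ _ (2 * theta r)).
    apply: (@le_trans _ _ (pr P (A r i))).
      by apply: pr_le => //; [exact: measurable_first_hit|move=> w []].
    by apply: (pr_window_le2 hB); rewrite ?(ltW th0)//; exact: cantor_left_ge1.
  rewrite -[leLHS]add0r lerD//; first by rewrite divr_ge0// mulr_ge0.
  rewrite -mulrA ler_peMr ?mulr_ge0 ?(ltW th0)// exprVn ler_pdivlMr ?exprn_gt0// mul1r.
  by rewrite ler_weXn2l ?ler1n// ltnW.
rewrite big_split /= -mulr_suml -mulr_sumr lerD//.
  by rewrite ler_wpM2r ?invr_ge0// sum_zero_bits_first_hit_le.
rewrite sum_zero_bits_weight.
have -> : (1 + 8^-1 : R) ^+ r.*2 = (81 / 64) ^+ r.
  by rewrite -mul2n exprM; congr (_ ^+ _); field.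
rewrite (_ : _ * _ = 2 * 8 ^+ K * (theta r * 2 ^+ r * (81 / 64) ^+ r)); last by ring.
by rewrite -!exprMn ler_wpM2l ?mulr_ge0 ?exprn_ge0// le_eqVlt; apply/orP; left; apply/eqP; congr (_ ^+ _); field.
Qed.

(** Only steps to a right child are tested, because a left child shares its parent's left endpoint.
    The thresholds are geometric in [k], with total at most [3 / 8] of [theta r]. *)
Definition oscillation r k : set T :=
  before (fun j => big_increment B (a (k + dep r) j) (a (k + dep r).+1 j.*2.+1)
                     (theta r * (2 / 3) ^+ k / 8)) (2 ^ (k + dep r)).

Lemma measurable_oscillation r k : measurable (oscillation r k).
Proof. by apply: measurable_before => j; exact: measurable_big_increment. Qed.

(** Union bound with the fourth-power tail. The factor in [k] is
    [2 * (1 / 16) * (3 / 2) ^ 4 = 81 / 128]; the [r] additional levels of the grid leave [2 ^- r];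
    and [128 * 8 ^ 4 = 2 ^ 19]. *)
Lemma pr_oscillation_le r k : pr P (oscillation r k) <= 2 ^+ 19 * 2^-1 ^+ r * (81 / 128) ^+ k.
Proof.
set n := dep r; set y := theta r * (2 / 3) ^+ k / 8.
have y0 : 0 < y by rewrite !divr_gt0// mulr_gt0// exprn_gt0//; lra.
apply: (le_trans (pr_before_le _ _ _)); first by move=> j; exact: measurable_big_increment.
apply: (@le_trans _ _ (\sum_(j < 2 ^ (k + n)) 128 * (g ^+ (k + n)) ^+ 2 / y ^+ 4)).
  apply: ler_sum => j _; rewrite cantor_leftS_odd.
  have a1 := cantor_left_ge1 g0 g1 (k + n) j.
  have gkn : 0 < g ^+ (k + n) by rewrite exprn_gt0.
  move: (g ^+ (k + n)) (a (k + n) j) gkn a1 => z b z0 b1.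
  apply: (le_trans (pr_big_increment_le hB _ _ y0)); [lra|lra|].
  rewrite ler_wpM2r ?invr_ge0 ?exprn_ge0 ?(ltW y0)// ler_wpM2l//.
  by rewrite ler_pXn2r ?nnegrE//; lra.
rewrite sumr_const card_ord -[leLHS]mulr_natr natrX gX /y gX (exprD (2 : R) k n) depE.
have pk := p2 k; have pr0 := p2 r.
have -> : (81 / 128 : R) ^+ k = (2 ^+ k) ^- 3 / ((2 / 3) ^+ k) ^+ 4.
  have -> : 81 / 128 = (2 ^+ 3)^-1 / (2 / 3) ^+ 4 :> R by field.
  by rewrite expr_div_n exprVn (exprAC 2 3 k) (exprAC (2 / 3) 4 k).
have q0 : (2 / 3 : R) ^+ k != 0 by rewrite expf_neq0//; lra.
rewrite exprVn le_eqVlt; apply/orP; left; apply/eqP.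
by field; rewrite q0 !gt_eqF.
Qed.

Lemma sum_oscillation_le r : pr P (\bigcup_k oscillation r k) <= 3 * 2 ^+ 19 * 2^-1 ^+ r.
Proof.
apply: pr_bigcup_le => [k|m]; first exact: measurable_oscillation.
apply: (@le_trans _ _ (2 ^+ 19 * 2^-1 ^+ r * (1 - 81 / 128)^-1)); last first.
  rewrite mulrAC ler_wpM2r ?exprn_ge0//.
  rewrite (_ : (1 - 81 / 128)^-1 = 128 / 47); last by field.
  by have := p2 19; move: (2 ^+ 19) => z z0; lra.
apply: (@le_trans _ _ (2 ^+ 19 * 2^-1 ^+ r * \sum_(k < m) (81 / 128) ^+ k)); last first.
  by rewrite ler_wpM2l ?mulr_ge0 ?exprn_ge0// sum_expr_le//; lra.
by rewrite mulr_sumr; apply: ler_sum => k _; exact: pr_oscillation_le.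
Qed.

(** The left endpoints of the intervals around a hit [t] form a chain from the grid to [t]; without
    an oscillation event, [B] moves little along it. *)
Lemma hit_subset r : (0 < r)%N ->
  hit B g `<=` before (A r) (2 ^ dep r) `|` \bigcup_k oscillation r k.
Proof.
move=> r0 w [t [[t0 /eqP]]]; rewrite subr_eq0 => /eqP Bt Ct; set n := dep r.
have [osc|nosc] := pselect ((\bigcup_k oscillation r k) w); first by right.
left; have [i iN it] := (cantor_setP g0 g1 t).1 Ct n; exists i => //.
have th0 : 0 < theta r by rewrite exprn_gt0.
have chain k : exists2 j, (j < 2 ^ (k + n))%N &
    a (k + n) j <= t <= a (k + n) j + g ^+ (k + n) /\
    `|B (a (k + n) j) w - B (a n i) w| <= theta r / 8 * \sum_(l < k) (2 / 3) ^+ l.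
  elim: k => [|k [j jk [jt hj]]].
    by exists i => //; split=> //; rewrite subrr normr0 big_ord0 mulr0.
  have [j' j'k j't] := (cantor_setP g0 g1 t).1 Ct (k + n).+1.
  have j'E : j'./2 = j.
    have [h1 h2] := cantor_left_parent g0 g1 (k + n) j'.
    apply: (cantor_left_inj_itv g0 g1 _ jt).
    by case/andP: j't => h3 h4; rewrite (le_trans h1 h3) (le_trans h4 h2).
  exists j' => //; split=> //; rewrite big_ord_recr /= mulrDr.
  have step : `|B (a (k + n).+1 j') w - B (a (k + n) j) w| <= theta r / 8 * (2 / 3) ^+ k.
    (* For a right child, a larger step would be an oscillation event; for a left child the step is
       zero. *)
    have := odd_double_half j'; rewrite j'E; case: (odd j') => /= <-.
      rewrite leNgt; apply/negP => hlt; apply: nosc; exists k => //; exists j => //.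
      by rewrite /big_increment /= (_ : _ * _ / 8 = theta r / 8 * (2 / 3) ^+ k)//; ring.
    by rewrite add0n -/(a (k + n).+1 j.*2) cantor_leftS_even subrr normr0 mulr_ge0 ?divr_ge0 ?exprn_ge0 ?(ltW th0)//; lra.
  move: hj step; rewrite !ler_norml.
  by move: (theta r / 8 * _) (theta r / 8 * _) (B (a _ j') w) (B _ w) (B _ w) => *; lra.
have th8 : 0 < theta r / 8 by rewrite divr_gt0.
have [del del0 hdel] := brownian_dist_lt hB w t0 th8.
have g01 : 0 <= g < 1 by lra.
have [k /(_ (k + n)%N (leq_addr _ _)) hk] := expr_lt_eventually g01 del0.
have [j _ [jt hj]] := chain k.
have h1 : `|B t w - B (a (k + n) j) w| < theta r / 8.
  by apply: hdel; rewrite ltr_norml; lra.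
have h2 : theta r / 8 * \sum_(l < k) (2 / 3 : R) ^+ l <= theta r * 3 / 8.
  apply: (@le_trans _ _ (theta r / 8 * (1 - 2 / 3)^-1)).
    by rewrite ler_wpM2l ?divr_ge0 ?(ltW th0)// sum_expr_le//; lra.
  by rewrite le_eqVlt; apply/orP; left; apply/eqP; field.
have h3 : (2 : R) ^- n <= theta r / 2.
  rewrite depE gX -invfM lef_pV2 ?posrE ?mulr_gt0 ?exprn_gt0//.
  have : (2 : R) <= 2 ^+ r by rewrite -[leLHS]expr1 ler_weXn2l// ler1n.
  move: (2 ^+ r : R) (p2 r) => x x0 x2.
  by rewrite [leRHS]exprSr ler_wpM2l// sqr_ge0.
have := cantor_function_itv g0 g1 Ct it; rewrite -Bt mulrDl (mul1r (2 ^- n)) => h4.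
(* The errors are [theta r / 8] from continuity at [t], [theta r * 3 / 8] from the chain and
   [theta r / 2] from the Cantor function, in total [theta r]. The last one relies on [0 < r]. *)
rewrite /window /= (bm_start hB) subr0; move: hj h1; rewrite !ler_norml ltr_norml -/n.
by move: (theta r) (theta r / 8 * _) (i%:R / 2 ^+ n : R) (2 ^- n) h2 h3 h4 => *; lra.
Qed.

Lemma pr_hit_quarter : pr P (hit B g) = 0.
Proof.
apply/eqP; rewrite eq_le pr_ge0 andbT; apply/ler_addgt0Pr => e e0; rewrite add0r.
have e30 : 0 < e / 3 by rewrite divr_gt0.
have E0 : 0 < 12 * expR 4 :> R by rewrite mulr_gt0 ?expR_gt0.
(* [K] is fixed first, to make the Markov term small; then [r] is taken large depending on [K], with
   a successor to ensure [0 < r]. *)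
pose K := (Num.bound (12 * expR 4 / (e / 3))).+1.
have hK : 12 * expR 4 / K%:R <= e / 3.
  rewrite ler_pdivrMr ?ltr0n// [leRHS]mulrC -ler_pdivrMr//.
  apply: (@le_trans _ _ (Num.bound (12 * expR 4 / (e / 3)))%:R); last by rewrite /K ler_nat.
  by rewrite ltW// archi_boundP// ltW// divr_gt0.
have K0 : (0 < K)%N by [].
clearbody K.
have q1 : 0 <= (81 / 128 : R) < 1 by lra.
have b0 : 0 < e / 3 / (2 * 8 ^+ K) by rewrite divr_gt0// mulr_gt0// exprn_gt0.
have [N1 hN1] := expr_lt_eventually q1 b0.
have b1 : 0 < e / 3 / (3 * 2 ^+ 19) by rewrite divr_gt0// mulr_gt0.
have [N2 hN2] := expr_lt_eventually (half_itv01 R) b1.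
pose r := (maxn N1 N2).+1.
have h1 := hN1 r (leqW (leq_maxl _ _)); have h2 := hN2 r (leqW (leq_maxr _ _)).
have mA i : measurable (A r i) by exact: measurable_window.
have mB := measurable_before mA (2 ^ dep r).
have mO : measurable (\bigcup_k oscillation r k).
  by apply: bigcup_measurable => k _; exact: measurable_oscillation.
have sub : hit B g `<=` before (A r) (2 ^ dep r) `|` \bigcup_k oscillation r k.
  exact: hit_subset.
apply: (le_trans (pr_le P (measurable_hit hB g0 g1) (measurableU _ _ mB mO) sub)).
apply: (le_trans (pr_setU_le _ mB mO)).
have h3 := pr_before_quarter_le r K0.
have h4 := sum_oscillation_le r.
move: h1; rewrite ltr_pdivlMr ?mulr_gt0 ?exprn_gt0// => h1.
move: h2; rewrite ltr_pdivlMr ?mulr_gt0 ?exprn_gt0// => h2.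
move: h1 h2 h3 h4 hK; rewrite [_ * (2 * 8 ^+ K)]mulrC [_ * (3 * 2 ^+ 19)]mulrC.
move: (pr P (before _ _)) (pr P (\bigcup_k _)) (_ / K%:R) (2 * _ * _) (3 * 2 ^+ 19 * _) => *; lra.
Qed.

End quarter.

Theorem theorem1p3 (R : realType) (d : measure_display) (T : measurableType d)
    (P : probability T R) (B : R -> {RV P >-> R})
    (hB : standard_brownian_motion B)
    (gamma : R) (hgamma0 : 0 < gamma) (hgamma1 : gamma < 1 / 2) :
  (0 < P [set w | zeros (fun t => B t w - cantor_function gamma t)%R
                  `&` cantor_set gamma !=set0])%E
  <-> gamma <> 1 / 4.
Proof.
rewrite -[X in P X]/(hit B gamma) (prE P (measurable_hit hB hgamma0 hgamma1)) lte_fin.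
split=> [hit0 gE|/eqP g14]; last exact: pr_hit_gt0.
by move: hit0; rewrite gE pr_hit_quarter// ltxx.
Qed.
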